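(* Let $N$ be an integer with $N\ge d_F+k-1$, let $M=N+2k+d_F$, let $\mathcal{Y}$ be the list of auxiliary matrix variables defined in the context, and let $T(x)$ be a tunable symmetric $2\times2$ polynomial matrix. The optimal value of the problem $$\begin{aligned}\min_{\gamma,\mathcal{Y},T(x)}\quad & c^T\gamma\\ \text{s.t.}\quad & \overline{\Omega}(\gamma,\mathcal{Y})\succeq0,\\ &\Pi_M^T\,Q_M(\gamma,\mathcal{Y})\,\Pi_M\succeq0,\\ & z^T\big[S(x;\gamma)-\Sigma_M(\gamma,\mathcal{Y})-(1-x^2)T(x)\big]z\ \text{ is a sum of squares of polynomials in }(x,z),\\ & z^TT(x)z\ \text{ is a sum of squares of polynomials in }(x,z),\end{aligned}$$ where $z\in\mathbb{R}^2$, is an upper bound for the optimal value of $$\min_{\gamma\in\mathbb{R}^s}\; c^T\gamma\quad\text{s.t.}\quad \mathcal{F}_\gamma\{w\}\ge0\ \text{ for all } w\in H.\qquad(\mathrm{P})$$ Moreover, if a minimizer $\gamma_N^\star$ (the $\gamma$-component of an optimal solution) exists in the former problem, it is a feasible point for (P).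
   Context: Setting. Let $m,k,l$ be integers with $1\le k\le m-1$ and $k\le l\le m$. For $w=[u,v]^T=[w_1,w_2]^T\in C^m([-1,1],\mathbb{R}^2)$ and $0\le i\le j\le m$ let $\mathcal{D}^{[i,j]}w=[\partial^iw_1,\dots,\partial^jw_1,\partial^iw_2,\dots,\partial^jw_2]^T$, let $\mathcal{B}^{[i,j]}w$ be the vector obtained by stacking $\mathcal{D}^{[i,j]}w(-1)$ and $\mathcal{D}^{[i,j]}w(1)$, and write $\mathcal{D}^j=\mathcal{D}^{[0,j]}$, $\mathcal{B}^j=\mathcal{B}^{[0,j]}$. Let $F(x;\gamma)=F_0(x)+\sum_{i=1}^s\gamma_iF_i(x)$, where the $F_i$ are symmetric $2(k+1)\times2(k+1)$ matrices of polynomials of degree at most $d_F$. Let $c\in\mathbb{R}^s$, $A\in\mathbb{R}^{p\times4(l+1)}$ and $$\mathcal{F}_\gamma\{w\}=\int_{-1}^1(\mathcal{D}^kw)^TF(x;\gamma)\mathcal{D}^kw\,dx,\qquad H=\{w\in C^m([-1,1],\mathbb{R}^2):A\,\mathcal{B}^lw=0\}.$$ For $a,b\in\{1,2\}$ and $\alpha,\beta\in\{0,\dots,k\}$ let $f_{ab}^{\alpha\beta}(x;\gamma)$ be the entry of $F(x;\gamma)$ in the row of $\partial^\alpha w_a$ and the column of $\partial^\beta w_b$, and let $\|\hat f_{ab}^{\alpha\beta}(\gamma)\|_1$ be the sum of the absolute values of its Legendre coefficients. Let $S(x;\gamma)$ be the symmetric $2\times2$ matrix with entries $S_{ab}=f_{ab}^{kk}$.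 Legendre expansions. Let $\mathcal{L}_n$ be the Legendre polynomial of degree $n$, and let $\hat w_{a,n}^\alpha=\frac{2n+1}{2}\int_{-1}^1\partial^\alpha w_a\,\mathcal{L}_n\,dx$, so $\partial^\alpha w_a=\sum_{n\ge0}\hat w_{a,n}^\alpha\mathcal{L}_n$. Let $W_{a,i}^\alpha=\sum_{n>i}\hat w_{a,n}^\alpha\mathcal{L}_n$, and write $U_M^k=W_{1,M}^k$, $V_M^k=W_{2,M}^k$. Let $\check w_a=[w_a(-1),\dots,\partial^{k-1}w_a(-1),\hat w_{a,0}^k,\dots,\hat w_{a,M}^k]^T\in\mathbb{R}^{k+M+1}$ and $\psi_M=[\check w_1^T,\check w_2^T]^T\in\mathbb{R}^{2(k+M+1)}$. Put $N_\alpha=N+\alpha$, $N_\beta=N+\beta$ if $(\alpha,\beta)\ne(k,k)$, and $N_\alpha=N_\beta=M$ if $\alpha=\beta=k$. With $f=f_{ab}^{\alpha\beta}$, define $$\mathcal{P}_{ab}^{\alpha\beta}=\sum_{i=0}^{N_\alpha}\sum_{j=0}^{N_\beta}\hat w_{a,i}^\alpha\hat w_{b,j}^\beta\int_{-1}^1f\mathcal{L}_i\mathcal{L}_j\,dx,\qquad \mathcal{R}_{ab}^{\alpha\beta}=\int_{-1}^1f\,W_{a,N_\alpha}^\alpha W_{b,N_\beta}^\beta\,dx,$$ $$\mathcal{Q}_{ab}^{\alpha\beta}=\sum_{i=0}^{N_\alpha}\hat w_{a,i}^\alpha\int_{-1}^1f\mathcal{L}_iW_{b,N_\beta}^\beta\,dx+\sum_{j=0}^{N_\beta}\hat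 w_{b,j}^\beta\int_{-1}^1f\mathcal{L}_jW_{a,N_\alpha}^\alpha\,dx ,$$ so that $\int_{-1}^1f\,\partial^\alpha w_a\,\partial^\beta w_b\,dx=\mathcal{P}_{ab}^{\alpha\beta}+\mathcal{Q}_{ab}^{\alpha\beta}+\mathcal{R}_{ab}^{\alpha\beta}$. Fixed matrices. The following matrices exist and are fixed; all identities and bounds hold for all $w\in C^m([-1,1],\mathbb{R}^2)$ and all $\gamma$. For all $a,b,\alpha,\beta$: $P_{ab}^{\alpha\beta}(\gamma)$ symmetric, affine in $\gamma$, with $\mathcal{P}_{ab}^{\alpha\beta}=\psi_M^TP_{ab}^{\alpha\beta}(\gamma)\psi_M$. For $(\alpha,\beta)\ne(k,k)$: $Q_{ab}^{\alpha\beta}(\gamma)$ symmetric, affine in $\gamma$, with $\mathcal{Q}_{ab}^{\alpha\beta}=\psi_M^TQ_{ab}^{\alpha\beta}(\gamma)\psi_M$; and $R_{ab}^{\alpha\beta}\succeq0$, $\Sigma_{ab}^{\alpha\beta}\succ0$ (of size $2\times 2$), independent of $\gamma$, with $$|\mathcal{R}_{ab}^{\alpha\beta}|\le\|\hat f_{ab}^{\alpha\beta}(\gamma)\|_1\Big(\psi_M^TR_{ab}^{\alpha\beta}\psi_M+\int_{-1}^1\begin{bmatrix}U_M^k\\ V_M^k\end{bmatrix}^T\Sigma_{ab}^{\alpha\beta}\begin{bmatrix}U_M^k\\ V_M^k\end{bmatrix}dx\Big).$$ Auxiliary variables. $\mathcal{Y}=\{Q_{11}^{kk},\Sigma_{11}^{kk},Q_{12}^{kk},\Sigma_{12}^{kk},Q_{22}^{kk},\Sigma_{22}^{kk}\}$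 with each $Q_{ab}^{kk}$ a symmetric $2d_F\times2d_F$ matrix and each $\Sigma_{ab}^{kk}$ a diagonal $2\times2$ matrix. Let $\Delta=\mathrm{Diag}\big(\tfrac{2}{2(M+1)+1},\dots,\tfrac{2}{2(M+d_F)+1}\big)$, let $\Phi_{ab}$ be the $d_F\times d_F$ matrix with entries $\int_{-1}^1S_{ab}(x;\gamma)\mathcal{L}_{M-d_F+i}\mathcal{L}_{M+j}\,dx$, $1\le i,j\le d_F$, and let $$Y_{11}=\begin{bmatrix}\Phi_{11}&0\\0&0\end{bmatrix},\quad Y_{12}=\tfrac12\begin{bmatrix}0&\Phi_{12}\\ \Phi_{12}&0\end{bmatrix},\quad Y_{22}=\begin{bmatrix}0&0\\0&\Phi_{22}\end{bmatrix},\quad \Omega_{ab}=\begin{bmatrix}Q_{ab}^{kk}&Y_{ab}\\ Y_{ab}^T&\Sigma_{ab}^{kk}\otimes\Delta\end{bmatrix}.$$ $\overline{\Omega}(\gamma,\mathcal{Y})$ is the block-diagonal matrix with blocks $\Omega_{11},\Omega_{12},\Omega_{22}$. Let $L$ be the matrix with $L\psi_M=[\hat w_{1,M+1-d_F}^k,\dots,\hat w_{1,M}^k,\hat w_{2,M+1-d_F}^k,\dots,\hat w_{2,M}^k]^T$. (If $d_F=0$ these auxiliary variables and LMIs are absent, i.e. the corresponding terms are zero.) The matrices $Q_M$ and $\Sigma_M$. $$Q_M(\gamma,\mathcal{Y})=P_{11}^{kk}+2P_{12}^{kk}+P_{22}^{kk}-L^T(Q_{11}^{kk}+2Q_{12}^{kk}+Q_{22}^{kk})L+\sum\big(P_{ab}^{\alpha\beta}+Q_{ab}^{\alpha\beta}-\|\hat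 f_{ab}^{\alpha\beta}(\gamma)\|_1R_{ab}^{\alpha\beta}\big),$$ $$\Sigma_M(\gamma,\mathcal{Y})=\Sigma_{11}^{kk}+2\Sigma_{12}^{kk}+\Sigma_{22}^{kk}+\sum\|\hat f_{ab}^{\alpha\beta}(\gamma)\|_1\Sigma_{ab}^{\alpha\beta},$$ where both sums are over all $a,b\in\{1,2\}$ and $(\alpha,\beta)\in\{0,\dots,k\}^2\setminus\{(k,k)\}$. The matrix $\Pi_M$. Let $P$ be the permutation matrix with $\mathcal{B}^lw=P\begin{bmatrix}\mathcal{B}^{k-1}w\\ \mathcal{B}^{[k,l]}w\end{bmatrix}$, let $J$ be the matrix with $\mathcal{B}^{k-1}w=J\psi_M$ for all $w\in C^m([-1,1],\mathbb{R}^2)$ (it exists), and let $K=AP\begin{bmatrix}J&0\\0&I\end{bmatrix}$. Let $\Lambda$ be a matrix with $\dim\mathcal{N}(K)$ columns whose range is the null space $\mathcal{N}(K)$; $\Pi_M$ consists of the first $2(k+M+1)$ rows of $\Lambda$. Hence $\psi_M=\Pi_M\zeta$ for some $\zeta$ whenever $w\in H$. Conventions. Optimal values are infima in $[-\infty,+\infty]$ ($+\infty$ if infeasible). $T(x)$ ranges over symmetric $2\times2$ polynomial matrices of some prescribed degree. The absolute values in $\|\hat f_{ab}^{\alpha\beta}(\gamma)\|_1$ can be replaced by slack variables $t$ with $-t\le\hat f_n(\gamma)\le t$, which makes the problem a semidefinite program. *)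

(* Defs.v *)
From HB Require Import structures.
From mathcomp Require Import all_boot all_order all_algebra.
From mathcomp Require Import all_classical all_reals all_analysis.

Set Implicit Arguments.
Unset Strict Implicit.
Unset Printing Implicit Defensive.

Import Order.TTheory GRing.Theory Num.Theory.
Import numFieldNormedType.Exports.

Local Open Scope classical_set_scope.
Local Open Scope ring_scope.

Notation II := (`[-1, 1]%classic).

(* Difference quotients are taken inside [-1,1], so that the derivative is
   one-sided at -1 and at 1, and the values of a function outside [-1,1] never
   matter at points of [-1,1]. *)
Definition dquot {R : realType} (f : R -> R) (x y : R) : R :=
  (f y - f x) / (y - x).

Definition deriv_in {R : realType} (f : R -> R) (x : R) : R :=
  lim (dquot f x y @[y --> within II (x^')]).

Definition pderiv {R : realType} (n : nat) (f : R -> R) : R -> R :=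
  iter n deriv_in f.

Definition Cm {R : realType} (m : nat) (w : 'I_2 -> R -> R) : Prop :=
  forall a : 'I_2,
    (forall i, (i < m)%N -> forall x, x \in II ->
       cvg (dquot (pderiv i (w a)) x y @[y --> within II (x^')])) /\
    {within II, continuous (pderiv m (w a))}.

Notation "'\intI' f" := (\int[lebesgue_measure]_(x in II) (f x))
  (at level 36, f at level 9) : ring_scope.

(* D^{[i,j]} w is [Dvec w i n] and B^{[i,j]} w is [Bvec w i n], where
   n = j - i + 1 is the number of derivatives. *)
Definition Dvec {R : realType} (w : 'I_2 -> R -> R) (i n : nat) (x : R) :
    'cV[R]_(n + n) :=
  col_mx (\col_(j < n) pderiv (i + j) (w 0) x) (\col_(j < n) pderiv (i + j) (w 1) x).

Notation dimB n := ((n + n) + (n + n))%N (only parsing).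

Definition Bvec {R : realType} (w : 'I_2 -> R -> R) (i n : nat) :
    'cV[R]_(dimB n) :=
  col_mx (Dvec w i n (-1)) (Dvec w i n 1).

(* Rodrigues' formula. *)
Definition legendre {R : realType} (n : nat) : {poly R} :=
  ((2 ^ n * n`!)%N%:R)^-1 *: (('X^2 - 1) ^+ n)^`(n).

Definition leg_coef {R : realType} (f : R -> R) (n : nat) : R :=
  (2 * n + 1)%N%:R / 2 * \intI (fun x => f x * (legendre n).[x]).

Definition leg_tail {R : realType} (f : R -> R) (i : nat) (x : R) : R :=
  limn (fun K : nat =>
    \sum_(i.+1 <= n < K) leg_coef f n * (legendre n).[x]).

(* The Legendre coefficients of p of index at least [size p] vanish. *)
Definition leg_norm1 {R : realType} (p : {poly R}) : R :=
  \sum_(n < size p) `| leg_coef (fun x => p.[x]) n |.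

Definition whut {R : realType} (w : 'I_2 -> R -> R) (a : 'I_2) (al n : nat) : R :=
  leg_coef (pderiv al (w a)) n.

Definition wtail {R : realType} (w : 'I_2 -> R -> R) (a : 'I_2) (al i : nat) :
    R -> R :=
  leg_tail (pderiv al (w a)) i.

Notation dimcheck k M := (k + M.+1)%N (only parsing).
Notation dimpsi k M := (dimcheck k M + dimcheck k M)%N (only parsing).

Definition wcheck {R : realType} (k M : nat) (w : 'I_2 -> R -> R) (a : 'I_2) :
    'cV[R]_(dimcheck k M) :=
  col_mx (\col_(i < k) pderiv i (w a) (-1)) (\col_(n < M.+1) whut w a k n).

Definition psi {R : realType} (k M : nat) (w : 'I_2 -> R -> R) :
    'cV[R]_(dimpsi k M) :=
  col_mx (wcheck k M w 0) (wcheck k M w 1).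

Definition UV {R : realType} (k M : nat) (w : 'I_2 -> R -> R) (x : R) : 'cV[R]_2 :=
  \col_a wtail w a k M x.

Definition qform {R : realType} (n : nat) (A : 'M[R]_n) (v : 'cV[R]_n) : R :=
  (v^T *m A *m v) 0 0.

Definition psd {R : realType} (n : nat) (A : 'M[R]_n) : Prop :=
  A^T = A /\ forall v : 'cV[R]_n, 0 <= qform A v.

Definition posdef {R : realType} (n : nat) (A : 'M[R]_n) : Prop :=
  A^T = A /\ forall v : 'cV[R]_n, v != 0 -> 0 < qform A v.

Definition affine_in {R : realType} (s n : nat) (P : 'cV[R]_s -> 'M[R]_n) : Prop :=
  exists (P0 : 'M[R]_n) (Pi : 'I_s -> 'M[R]_n),
    forall gamma, P gamma = P0 + \sum_(i < s) gamma i 0 *: Pi i.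

(* Row and column dimensions are separate because in the application they are
   equal but not convertible. *)
Definition is_permutation {R : realType} (n1 n2 : nat) (P : 'M[R]_(n1, n2)) : Prop :=
  exists2 f : 'I_n1 -> 'I_n2, bijective f & P = \matrix_(i, j) (f i == j)%:R.

Definition is_diag {R : realType} (n : nat) (A : 'M[R]_n) : Prop :=
  forall i j, i != j -> A i j = 0.

Definition deg_le {R : realType} (m n d : nat) (A : 'M[{poly R}]_(m, n)) : Prop :=
  forall i j, (size (A i j) <= d.+1)%N.

Definition Fmx {R : realType} (k s : nat) (F0 : 'M[{poly R}]_(k.+1 + k.+1))
    (F : 'I_s -> 'M[{poly R}]_(k.+1 + k.+1)) (gamma : 'cV[R]_s) :
    'M[{poly R}]_(k.+1 + k.+1) :=
  F0 + \sum_(i < s) (gamma i 0)%:P *: F i.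

(* Position of the derivative of order al of w_a in D^k w. *)
Definition pos (k : nat) (a : 'I_2) (al : 'I_k.+1) : 'I_(k.+1 + k.+1) :=
  if a == 0 then lshift k.+1 al else rshift k.+1 al.

(* Below, G stands for F(.; gamma) at the current gamma. *)
Definition fent {R : realType} (k : nat) (G : 'M[{poly R}]_(k.+1 + k.+1))
    (a b : 'I_2) (al be : 'I_k.+1) : {poly R} :=
  G (pos a al) (pos b be).

Definition Smx {R : realType} (k : nat) (G : 'M[{poly R}]_(k.+1 + k.+1)) :
    'M[{poly R}]_2 :=
  \matrix_(a, b) fent G a b ord_max ord_max.

Definition Fcal {R : realType} (k : nat) (G : 'M[{poly R}]_(k.+1 + k.+1))
    (w : 'I_2 -> R -> R) : R :=
  \intI (fun x => qform (map_mx (fun q : {poly R} => q.[x]) G) (Dvec w 0 k.+1 x)).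

Definition inH {R : realType} (m l p : nat) (A : 'M[R]_(p, dimB l.+1))
    (w : 'I_2 -> R -> R) : Prop :=
  Cm m w /\ A *m Bvec w 0 l.+1 = 0.

Definition kk {k : nat} : 'I_k.+1 * 'I_k.+1 := (ord_max, ord_max).

(* N_al and N_be are [cut N M al be al] and [cut N M al be be]. *)
Definition cut {k : nat} (N M : nat) (al be de : 'I_k.+1) : nat :=
  if (al, be) == kk then M else (N + de)%N.

Definition Pcal {R : realType} (k N M : nat) (G : 'M[{poly R}]_(k.+1 + k.+1))
    (w : 'I_2 -> R -> R) (a b : 'I_2) (al be : 'I_k.+1) : R :=
  \sum_(i < (cut N M al be al).+1) \sum_(j < (cut N M al be be).+1)
    whut w a al i * whut w b be j *
    \intI (fun x => (fent G a b al be).[x] * (legendre i).[x] * (legendre j).[x]).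

Definition Qcal {R : realType} (k N M : nat) (G : 'M[{poly R}]_(k.+1 + k.+1))
    (w : 'I_2 -> R -> R) (a b : 'I_2) (al be : 'I_k.+1) : R :=
  \sum_(i < (cut N M al be al).+1) whut w a al i *
    \intI (fun x => (fent G a b al be).[x] * (legendre i).[x] *
                    wtail w b be (cut N M al be be) x) +
  \sum_(j < (cut N M al be be).+1) whut w b be j *
    \intI (fun x => (fent G a b al be).[x] * (legendre j).[x] *
                    wtail w a al (cut N M al be al) x).

Definition Rcal {R : realType} (k N M : nat) (G : 'M[{poly R}]_(k.+1 + k.+1))
    (w : 'I_2 -> R -> R) (a b : 'I_2) (al be : 'I_k.+1) : R :=
  \intI (fun x => (fent G a b al be).[x] * wtail w a al (cut N M al be al) x *
                  wtail w b be (cut N M al be be) x).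

Record auxvars (R : realType) (dF : nat) := AuxVars {
  Q11 : 'M[R]_(dF + dF); S11 : 'M[R]_2;
  Q12 : 'M[R]_(dF + dF); S12 : 'M[R]_2;
  Q22 : 'M[R]_(dF + dF); S22 : 'M[R]_2 }.

Definition aux_wf {R : realType} (dF : nat) (Y : auxvars R dF) : Prop :=
  [/\ (Q11 Y)^T = Q11 Y, (Q12 Y)^T = Q12 Y & (Q22 Y)^T = Q22 Y] /\
  [/\ is_diag (S11 Y), is_diag (S12 Y) & is_diag (S22 Y)].

Definition Delta {R : realType} (M dF : nat) : 'M[R]_dF :=
  diag_mx (\row_(i < dF) (2 / (2 * (M + i.+1) + 1)%N%:R)).

Definition Phi {R : realType} (k M dF : nat) (G : 'M[{poly R}]_(k.+1 + k.+1))
    (a b : 'I_2) : 'M[R]_dF :=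
  \matrix_(i < dF, j < dF)
    \intI (fun x => (Smx G a b).[x] * (legendre (M - dF + i.+1)).[x] *
                    (legendre (M + j.+1)).[x]).

(* Kronecker product of a 2 x 2 matrix with D, written by blocks. *)
Definition kron2 {R : realType} (n : nat) (S : 'M[R]_2) (D : 'M[R]_n) :
    'M[R]_(n + n) :=
  block_mx (S 0 0 *: D) (S 0 1 *: D) (S 1 0 *: D) (S 1 1 *: D).

Definition Y11 {R : realType} (k M dF : nat) (G : 'M[{poly R}]_(k.+1 + k.+1)) :
    'M[R]_(dF + dF) :=
  block_mx (Phi M dF G 0 0) 0 0 0.

Definition Y12 {R : realType} (k M dF : nat) (G : 'M[{poly R}]_(k.+1 + k.+1)) :
    'M[R]_(dF + dF) :=
  2^-1 *: block_mx 0 (Phi M dF G 0 1) (Phi M dF G 0 1) 0.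

Definition Y22 {R : realType} (k M dF : nat) (G : 'M[{poly R}]_(k.+1 + k.+1)) :
    'M[R]_(dF + dF) :=
  block_mx 0 0 0 (Phi M dF G 1 1).

Definition Omega {R : realType} (M dF : nat) (Q : 'M[R]_(dF + dF)) (S : 'M[R]_2)
    (Y : 'M[R]_(dF + dF)) : 'M[R]_((dF + dF) + (dF + dF)) :=
  block_mx Q Y Y^T (kron2 S (Delta M dF)).

Definition OmegaBar {R : realType} (k M dF : nat) (G : 'M[{poly R}]_(k.+1 + k.+1))
    (Y : auxvars R dF) :=
  block_mx (Omega M (Q11 Y) (S11 Y) (Y11 M dF G)) 0 0
    (block_mx (Omega M (Q12 Y) (S12 Y) (Y12 M dF G)) 0 0
              (Omega M (Q22 Y) (S22 Y) (Y22 M dF G))).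

(* The vector L psi_M. *)
Definition last_coefs {R : realType} (k M dF : nat) (w : 'I_2 -> R -> R) :
    'cV[R]_(dF + dF) :=
  col_mx (\col_(i < dF) whut w 0 k (M + 1 - dF + i))
         (\col_(i < dF) whut w 1 k (M + 1 - dF + i)).

(* Families of matrices indexed by (a, b, al, be). *)
Definition fam (R : realType) (k n : nat) : Type :=
  'I_2 -> 'I_2 -> 'I_k.+1 -> 'I_k.+1 -> 'M[R]_n.

(* Only the entries with (al, be) != (k, k) of Q and Rm are used. *)
Definition QM {R : realType} (k M dF : nat) (G : 'M[{poly R}]_(k.+1 + k.+1))
    (L : 'M[R]_(dF + dF, dimpsi k M)) (P Q Rm : fam R k (dimpsi k M))
    (Y : auxvars R dF) : 'M[R]_(dimpsi k M) :=
  P 0 0 ord_max ord_max + 2 *: P 0 1 ord_max ord_max + P 1 1 ord_max ord_max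
  - L^T *m (Q11 Y + 2 *: Q12 Y + Q22 Y) *m L
  + \sum_(a < 2) \sum_(b < 2) \sum_(ab : 'I_k.+1 * 'I_k.+1 | ab != kk)
      (P a b ab.1 ab.2 + Q a b ab.1 ab.2
       - leg_norm1 (fent G a b ab.1 ab.2) *: Rm a b ab.1 ab.2).

(* For dF = 0 the auxiliary variables are absent. The Q terms of QM and the
   constraint on OmegaBar are then empty by their dimensions; the 2 x 2
   matrices S11, S12, S22 have to be discarded explicitly. *)
Definition SigmaM {R : realType} (k dF : nat) (G : 'M[{poly R}]_(k.+1 + k.+1))
    (Sig : fam R k 2) (Y : auxvars R dF) : 'M[R]_2 :=
  (if dF == 0%N then 0 else S11 Y + 2 *: S12 Y + S22 Y)
  + \sum_(a < 2) \sum_(b < 2) \sum_(ab : 'I_k.+1 * 'I_k.+1 | ab != kk)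
      leg_norm1 (fent G a b ab.1 ab.2) *: Sig a b ab.1 ab.2.

Definition Kmx {R : realType} (k l M p : nat) (A : 'M[R]_(p, dimB l.+1))
    (P : 'M[R]_(dimB l.+1, dimB k + dimB (l.+1 - k)))
    (J : 'M[R]_(dimB k, dimpsi k M)) :
    'M[R]_(p, dimpsi k M + dimB (l.+1 - k)) :=
  A *m P *m block_mx J 0 0 1%:M.

(* The columns of La are as many as the dimension of the null space of K (the
   left null space of K^T in the row-vector convention of the library) and
   span it. *)
Definition null_basis {R : realType} (p n q : nat) (K : 'M[R]_(p, n))
    (La : 'M[R]_(n, q)) : Prop :=
  q = \rank (kermx K^T) /\
  forall v : 'cV[R]_n, K *m v = 0 <-> exists zeta : 'cV[R]_q, v = La *m zeta.

(* Polynomials in (x, z) are elements of R[x][z_1][z_2]. *)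
Definition zvar {R : realType} (a : 'I_2) : {poly {poly {poly R}}} :=
  if a == 0 then 'X%:P else 'X.

Definition zTz {R : realType} (T : 'M[{poly R}]_2) : {poly {poly {poly R}}} :=
  \sum_(a < 2) \sum_(b < 2) zvar a * (T a b)%:P%:P * zvar b.

Definition is_sos {R : realType} (p : {poly {poly {poly R}}}) : Prop :=
  exists qs : seq {poly {poly {poly R}}}, p = \sum_(q <- qs) q ^+ 2.

Definition objective {R : realType} (s : nat) (c gamma : 'cV[R]_s) : R :=
  (c^T *m gamma) 0 0.

Definition feasibleP {R : realType} (m k l s p : nat)
    (F0 : 'M[{poly R}]_(k.+1 + k.+1)) (F : 'I_s -> 'M[{poly R}]_(k.+1 + k.+1))
    (A : 'M[R]_(p, dimB l.+1)) (gamma : 'cV[R]_s) : Prop :=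
  forall w, inH m A w -> 0 <= Fcal (Fmx F0 F gamma) w.

(* dT is the prescribed degree of the tunable polynomial matrix T. *)
Definition feasibleSDP {R : realType} (k s dF dT M q : nat)
    (F0 : 'M[{poly R}]_(k.+1 + k.+1)) (F : 'I_s -> 'M[{poly R}]_(k.+1 + k.+1))
    (P Q : 'cV[R]_s -> fam R k (dimpsi k M)) (Rm : fam R k (dimpsi k M))
    (Sig : fam R k 2) (L : 'M[R]_(dF + dF, dimpsi k M))
    (Pi : 'M[R]_(dimpsi k M, q))
    (gamma : 'cV[R]_s) (Y : auxvars R dF) (T : 'M[{poly R}]_2) : Prop :=
  let G := Fmx F0 F gamma in
  [/\ aux_wf Y /\ (T^T = T /\ deg_le dT T),
      psd (OmegaBar M G Y),
      psd (Pi^T *m QM G L (P gamma) (Q gamma) Rm Y *m Pi),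
      is_sos (zTz (Smx G - map_mx polyC (SigmaM G Sig Y) - (1 - 'X^2) *: T)) &
      is_sos (zTz T)].

(* Infimum in the extended reals, +oo over an empty set. *)
Definition optval {R : realType} (s : nat) (c : 'cV[R]_s) (X : set 'cV[R]_s) :
    \bar R :=
  ereal_inf [set (objective c gamma)%:E | gamma in X].

(* Main.v *)
Require Import Defs.
From HB Require Import structures.
From mathcomp Require Import all_boot all_order all_algebra.
From mathcomp Require Import all_classical all_reals all_analysis.
From mathcomp Require Import ring lra zify.

Set Implicit Arguments.
Unset Strict Implicit.
Unset Printing Implicit Defensive.

Import Order.TTheory GRing.Theory Num.Theory.
Import numFieldNormedType.Exports.

Local Open Scope classical_set_scope.
Local Open Scope ring_scope.

(** Feasibility of the semidefinite program at gamma makes gamma feasible for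
    (P); both claims follow, the first because an infimum decreases when the
    set grows.

    Fix w in H.  Replacing each derivative of w by a partial Legendre sum plus
    a remainder splits the functional into the P, Q and R parts
    ([Fcal_split]).  Off the leading block (k, k), P and Q are quadratic forms
    in the state vector psi and R is bounded below by its given estimate.  In
    the leading block, P is again a quadratic form in psi, and R is the
    integral of V^T S V, where V is the vector of the remainders of the
    highest derivatives.  The leading cross term Q is not a function of psi:
    since the entries of S have degree at most dF, it is a bilinear form
    2 e^T Y g between the last dF coefficients e kept in psi and the first dF
    coefficients g of the remainder ([Qcal_leading]).  Nonnegativity of the
    form of Omega at the vector (e, g) gives
      2 e^T Y g >= - e^T Q e - g^T (Sigma (x) Delta) g,
    where (x) is the Kronecker product, and Bessel's inequality bounds the
    last term by the integral of V^T Sigma V ([Omega_cross_bound]); here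
    Sigma is diagonal and nonnegative.  Adding up ([Fcal_lower_bound]),
      F(w) >= psi^T Q_M psi + integral of V^T (S - Sigma_M) V.
    The first term is nonnegative because the boundary conditions put psi in
    the range of Pi_M ([null_basis_state]), the second because the two
    sum-of-squares constraints make S - Sigma_M positive semidefinite at every
    point of [-1,1] ([sos_certificate]).

    The analytic point is that the tails are pointwise limits of series, so
    the splitting requires the Legendre series of a function to converge back
    to it almost everywhere.  The derivatives involved are differentiable on
    [-1,1], and for such functions the series converges at every interior
    point ([legendre_series_cvg]): by the Christoffel-Darboux identity the
    error of a partial sum at x is a combination of two consecutive Legendre
    coefficients of the difference quotient at x, weighted by values L_n(x).
    Bessel's inequality and the decay of L_n(x) like n^(-1/2), itself a
    consequence of a monotone energy for Legendre's equation
    ([legendre_bound]), drive it to zero. *)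

(** * Integrals of continuous functions over [-1,1] *)

Section ContinuousFunctions.
Context {R : realType}.
Implicit Types f g : R -> R.

Definition contI f : Prop := {within II, continuous f}.

Lemma contIP f : contI f <->
  forall x : R, x \in II -> f y @[y --> within II (nbhs x)] --> f x.
Proof.
rewrite /contI subspace_continuousP; split=> h x hx; apply: h.
  by rewrite inE in hx.
by rewrite inE.
Qed.

Lemma contI_continuous f : continuous f -> contI f.
Proof. exact: continuous_subspaceT. Qed.

Lemma contI_horner (p : {poly R}) : contI (fun x => p.[x]).
Proof. by apply: contI_continuous; exact: continuous_horner. Qed.

Lemma contI_cst (c : R) : contI (fun=> c).
Proof. by apply: contI_continuous => x; exact: cvg_cst. Qed.

Lemma contID f g : contI f -> contI g -> contI (fun x => f x + g x).
Proof. by move=> cf cg x; apply: cvgD; [exact: cf|exact: cg]. Qed.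

Lemma contIB f g : contI f -> contI g -> contI (fun x => f x - g x).
Proof. by move=> cf cg x; apply: cvgB; [exact: cf|exact: cg]. Qed.

Lemma contIM f g : contI f -> contI g -> contI (fun x => f x * g x).
Proof. by move=> cf cg x; apply: cvgM; [exact: cf|exact: cg]. Qed.

Lemma contI_sum (I : Type) (r : seq I) (P : pred I) (F : I -> R -> R) :
  (forall i, P i -> contI (F i)) -> contI (fun x => \sum_(i <- r | P i) F i x).
Proof.
move=> cF; elim: r => [|i r IH].
  rewrite (_ : (fun x => _) = (fun=> 0)); first exact: contI_cst.
  by apply/funext => x; rewrite big_nil.
have [Pi|nPi] := boolP (P i).
  rewrite (_ : (fun x => _) = (fun x => F i x + \sum_(j <- r | P j) F j x)).
    by apply: contID => //; exact: cF.
  by apply/funext => x; rewrite big_cons Pi.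
rewrite (_ : (fun x => _) = (fun x => \sum_(j <- r | P j) F j x)) //.
by apply/funext => x; rewrite big_cons (negbTE nPi).
Qed.

Lemma measurable_II : measurable (II : set R).
Proof. exact: measurable_itv. Qed.

Lemma contI_integrable f : contI f -> lebesgue_measure.-integrable II (EFin \o f).
Proof.
by move=> cf; apply: continuous_compact_integrable => //; exact: segment_compact.
Qed.

Lemma intID f g : contI f -> contI g ->
  \intI (fun x => f x + g x) = \intI f + \intI g.
Proof.
by move=> cf cg; apply: RintegralD; [exact: measurable_II|exact: contI_integrable..].
Qed.

Lemma intIB f g : contI f -> contI g ->
  \intI (fun x => f x - g x) = \intI f - \intI g.
Proof.
by move=> cf cg; apply: RintegralB; [exact: measurable_II|exact: contI_integrable..].
Qed.

Lemma intIZ (c : R) f : contI f -> \intI (fun x => c * f x) = c * \intI f.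
Proof.
by move=> cf; apply: RintegralZl; [exact: measurable_II|exact: contI_integrable].
Qed.

Lemma intI0 : \intI (fun=> 0 : R) = 0.
Proof.
by have := @intIZ 0 (fun=> 0) (@contI_cst 0); rewrite !mul0r.
Qed.

Lemma intI_sum (I : Type) (r : seq I) (P : pred I) (F : I -> R -> R) :
  (forall i, P i -> contI (F i)) ->
  \intI (fun x => \sum_(i <- r | P i) F i x) = \sum_(i <- r | P i) \intI (F i).
Proof.
move=> cF; elim: r => [|i r IH].
  by under eq_Rintegral do rewrite big_nil; rewrite big_nil intI0.
under eq_Rintegral do rewrite big_cons.
rewrite big_cons; case: ifP => // Pi.
by rewrite intID -?IH //; [exact: cF|exact: contI_sum].
Qed.

Lemma intI_ge0 f : (forall x, x \in II -> 0 <= f x) -> 0 <= \intI f.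
Proof. by move=> h; apply: Rintegral_ge0 => x hx; apply: h; rewrite inE. Qed.

Lemma eq_intI f g : (forall x, x \in II -> f x = g x) -> \intI f = \intI g.
Proof. by move=> fg; apply: eq_Rintegral => x hx; exact: fg. Qed.

(** The endpoints are a null set.  Tails of Legendre series are known only on
    the open interval, and are replaced by continuous functions through this
    lemma. *)
Lemma eq_intI_interior f g : contI g ->
  (forall x, -1 < x < 1 -> f x = g x) -> \intI f = \intI g.
Proof.
move=> cg fg.
have mg : measurable_fun (`]-1, 1[%classic : set R) g.
  apply: measurable_funS (measurable_realfun.subspace_continuous_measurable_fun _ cg).
  - exact: measurable_II.
  - by apply: subset_itvW => //; rewrite bnd_simp.
  - exact: measurable_II.
rewrite /Rintegral; congr fine; apply: eq_integral_itv_bounded => //.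
  apply: eq_measurable_fun mg => x; rewrite inE /= in_itv /= => hx.
  by rewrite fg.
Qed.

(** This is how orthogonality is reduced to polynomial algebra. *)
Lemma intI_deriv (p : {poly R}) : \intI (fun x => p^`().[x]) = p.[1] - p.[-1].
Proof.
rewrite /Rintegral (@continuous_FTC2 R _ (horner p)) //.
- exact: contI_horner.
- split.
  + by move=> x _; exact: derivable_horner.
  + by apply: cvg_at_right_filter; exact: continuous_horner.
  + by apply: cvg_at_left_filter; exact: continuous_horner.
- by move=> x _; rewrite derivE.
Qed.

Lemma intI_cst (c : R) : \intI (fun=> c) = 2 * c.
Proof.
transitivity (\intI (fun x => (c%:P * 'X)^`().[x])).
  by apply: eq_intI => x _; rewrite derivM derivC derivX !hornerE.
by rewrite intI_deriv !hornerE; ring.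
Qed.

End ContinuousFunctions.

#[local] Hint Resolve contI_horner contI_cst : core.

(** * Algebra of Legendre polynomials *)

Section LegendreAlgebra.
Context {R : realType}.
Local Notation L n := (@legendre R n).

Lemma derivn_mulX (q : {poly R}) n :
  ('X * q)^`(n.+1) = 'X * q^`(n.+1) + n.+1%:R * q^`(n).
Proof.
elim: n => [|n IH]; first by rewrite !derivn1 derivM derivX /=; ring.
rewrite derivnS IH derivD !derivM derivX -!derivnS -polyC1 -polyCMn derivC.
ring.
Qed.

(** The unnormalized Legendre polynomials, on which the identities are proved
   without divisions. *)
Let rho n : {poly R} := (('X^2 - 1) ^+ n)^`(n).
Let nrm n : R := (2 ^ n * n`!)%N%:R.

Let nrm_neq0 n : nrm n != 0.
Proof. by rewrite pnatr_eq0 muln_eq0 expn_eq0 /= -lt0n fact_gt0. Qed.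

Let rhoE n : rho n = (nrm n)%:P * L n.
Proof. by rewrite mul_polyC scalerA divff ?nrm_neq0 // scale1r. Qed.

Let nrmS n : nrm n.+1 = 2 * n.+1%:R * nrm n.
Proof. by rewrite /nrm expnS factS mulnACA !natrM; ring. Qed.

Let deriv_base n :
  (('X^2 - 1) ^+ n.+1)^`() = 2 * n.+1%:R * ('X * ('X^2 - 1) ^+ n) :> {poly R}.
Proof.
by rewrite deriv_exp derivB derivXn -polyC1 derivC /= expr1 -mulr_natl; ring.
Qed.

(** The (n+2)-nd derivative of (X^2-1)^(n+2) is computed in two ways: by
   differentiating the power once first, and by expanding the product of
   X^2-1 with (X^2-1)^(n+1) by Leibniz' rule.  Comparing them expresses the
   lower derivative of (X^2-1)^(n+1) through [rho]; Legendre's equation and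
   all the recurrences follow from this. *)
Let rho_up n :
  rho n.+2 = 2 * n.+2%:R * ('X * rho n.+1 + n.+1%:R * (('X^2 - 1) ^+ n.+1)^`(n)).
Proof.
rewrite /rho derivSn deriv_base.
by rewrite -natrM -polyC_natr mul_polyC derivnZ derivn_mulX mul_polyC.
Qed.

Let rho_up' n :
  rho n.+2 = ('X^2 - 1) * (rho n.+1)^`() + n.+2%:R * 2 * ('X * rho n.+1)
             + (n.+1 * n.+2)%:R * (('X^2 - 1) ^+ n.+1)^`(n).
Proof.
set q := ('X^2 - 1) ^+ n.+1.
have -> : rho n.+2 = ('X * ('X * q) - q)^`(n.+2).
  by rewrite /rho exprS -/q; congr derivn; ring.
by rewrite derivnB !derivn_mulX /rho -/q -derivnS natrM; ring.
Qed.

Let rho_prim n :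
  (n.+1 * n.+2)%:R * (('X^2 - 1) ^+ n.+1)^`(n) = ('X^2 - 1) * (rho n.+1)^`().
Proof.
have := rho_up' n; rewrite rho_up => h.
apply: (@addrI _ (2 * n.+2%:R * ('X * rho n.+1))).
apply: (@addIr _ ((n.+1 * n.+2)%:R * (('X^2 - 1) ^+ n.+1)^`(n))).
transitivity (2 * n.+2%:R * ('X * rho n.+1 + n.+1%:R * (('X^2 - 1) ^+ n.+1)^`(n))).
  by rewrite natrM; ring.
by rewrite h; ring.
Qed.

Lemma legendre0 : L 0 = 1.
Proof. by rewrite /legendre expn0 fact0 muln1 invr1 scale1r expr0 derivn0. Qed.

Lemma legendre_step n :
  n.+1%:R * L n.+1 = n.+1%:R * ('X * L n) + ('X^2 - 1) * (L n)^`().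
Proof.
have nz2 : (2 * nrm n)%:P != 0 by rewrite polyC_eq0 mulf_neq0 ?nrm_neq0 ?pnatr_eq0.
apply: (mulfI nz2).
have -> : (2 * nrm n)%:P * (n.+1%:R * L n.+1) = rho n.+1.
  by rewrite rhoE nrmS !polyCM !polyC_natr; ring.
have -> : (2 * nrm n)%:P * (n.+1%:R * ('X * L n) + ('X^2 - 1) * (L n)^`())
    = 2 * n.+1%:R * ('X * rho n) + 2 * (('X^2 - 1) * (rho n)^`()).
  by rewrite rhoE derivM derivC polyCM polyC_natr; ring.
case: n {nz2} => [|n].
  rewrite {1}/rho derivSn deriv_base /= /rho expr0 -polyC1 derivC derivn0.
  by ring.
rewrite rho_up -rho_prim natrM; ring.
Qed.

Lemma legendre_ode n : (('X^2 - 1) * (L n)^`())^`() = (n * n.+1)%:R * L n.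
Proof.
case: n => [|n]; first by rewrite legendre0 -polyC1 !derivC mulr0 derivC mul0n; ring.
have nz : (nrm n.+1)%:P != 0 by rewrite polyC_eq0.
apply: (mulfI nz).
transitivity ((('X^2 - 1) * (rho n.+1)^`())^`()).
  rewrite rhoE !mul_polyC (derivZ (nrm n.+1) (L n.+1)) -scalerAr.
  by rewrite (derivZ (nrm n.+1) (_ * _)).
rewrite -rho_prim -polyC_natr mul_polyC derivZ -derivnS -/(rho n.+1).
by rewrite -mul_polyC polyC_natr rhoE; ring.
Qed.

Lemma legendre_deriv n : (L n.+1)^`() = n.+1%:R * L n + 'X * (L n)^`().
Proof.
have nz : n.+1%:R != 0 :> {poly R} by rewrite -polyC_natr polyC_eq0 pnatr_eq0.
apply: (mulfI nz); have := congr1 (@deriv R) (legendre_step n).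
rewrite derivD legendre_ode -(polyC_natr R n.+1) !derivM derivC derivX polyC_natr.
by rewrite mul0r add0r => ->; rewrite natrM; ring.
Qed.

(** Backward companion of [legendre_step]: the derivative of the same
    polynomial occurs with the opposite sign, so that adding the two gives the
    three-term recurrence. *)
Lemma legendre_back n :
  n.+1%:R * L n = n.+1%:R * ('X * L n.+1) - ('X^2 - 1) * (L n.+1)^`().
Proof.
rewrite legendre_deriv.
transitivity ('X * (n.+1%:R * L n.+1) -
   ('X^2 - 1) * (n.+1%:R * L n + 'X * (L n)^`())); last by ring.
by rewrite legendre_step; ring.
Qed.

Lemma legendre1 : L 1 = 'X.
Proof.
have := legendre_step 0.
by rewrite legendre0 -polyC1 derivC !mul1r mulr0 addr0 mulr1.
Qed.

(** At [n = 0] the predecessor [n.-1] is junk, but it is multiplied by 0. *)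
Lemma legendre_rec n :
  n.+1%:R * L n.+1 + n%:R * L n.-1 = (2 * n + 1)%:R * ('X * L n).
Proof.
case: n => [|n] /=; first by rewrite legendre1 legendre0; ring.
rewrite legendre_step legendre_back natrD natrM; ring.
Qed.

Lemma legendre_rec_horner n x :
  (2 * n + 1)%:R * (x * (L n).[x]) = n.+1%:R * (L n.+1).[x] + n%:R * (L n.-1).[x].
Proof.
have := congr1 (fun p : {poly R} => p.[x]) (legendre_rec n).
rewrite -!(polyC_natr R) /=; move: (L n.+1) (L n) (L n.-1) => u v w.
by rewrite !(hornerD, hornerM, hornerC, hornerX) => <-.
Qed.

Lemma size_legendre n : size (L n) = n.+1.
Proof.
have h : size (L n) = n.+1 /\ size (L n.+1) = n.+2; last by case: h.
elim: n => [|n [IH0 IH1]].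
  by rewrite legendre0 legendre1 size_poly1 size_polyX.
split=> //.
have ne (j : nat) : j.+1%:R != 0 :> R by rewrite pnatr_eq0.
have nz : L n.+1 != 0 by rewrite -size_poly_eq0 IH1.
have -> : size (L n.+2) = size (n.+2%:R * L n.+2).
  by rewrite -(polyC_natr R) mul_polyC (@size_scale R n.+2%:R).
have -> : n.+2%:R * L n.+2 = (2 * n.+1 + 1)%:R * ('X * L n.+1) - n.+1%:R * L n.
  by rewrite -legendre_rec /= addrK.
have sXL : size ('X * L n.+1) = n.+3 by rewrite mulrC size_mulX // IH1.
rewrite -!(polyC_natr R) !mul_polyC size_polyDl (@size_scale R (_ + 1)%:R) ?addn1 ?sXL //.
by rewrite size_polyN (@size_scale R n.+1%:R) // IH0.
Qed.

End LegendreAlgebra.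

(** * Orthogonality *)

Section LegendreOrthogonality.
Context {R : realType}.
Local Notation L n := (@legendre R n).

(** Legendre's operator is self-adjoint: the product, times the difference of
    the two eigenvalues, is the derivative of the Wronskian-like [W], which
    vanishes at both endpoints. *)
Lemma legendre_orthogonal (n m : nat) : n != m ->
  \intI (fun x => (L n).[x] * (L m).[x]) = 0.
Proof.
move=> nm.
pose W : {poly R} := ('X^2 - 1) * (L n)^`() * L m - ('X^2 - 1) * (L m)^`() * L n.
pose lam (j : nat) : R := (j * j.+1)%:R.
have dW : W^`() = (lam n - lam m)%:P * (L n * L m).
  rewrite /W derivB derivM legendre_ode [X in _ - X]derivM legendre_ode.
  by rewrite polyCB /lam !polyC_natr; ring.
have W0 : W.[1] - W.[-1] = 0.
  by rewrite /W; move: (L n) (L m) => p q; rewrite !hornerE; ring.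
have : (lam n - lam m) * \intI (fun x => (L n).[x] * (L m).[x]) = 0.
  rewrite -intIZ; last exact: contIM.
  rewrite -W0 -intI_deriv dW.
  by apply: eq_intI => x _; rewrite hornerM hornerC hornerM.
move/eqP; rewrite mulf_eq0 => /orP[|/eqP//].
rewrite subr_eq0 /lam eqr_nat => /eqP h; exfalso; move: nm.
nia.
Qed.

(** Both norms, of [L n] and of [L n.+1], are read off the same integral of
    x * L n * L n.+1 by the recurrence at [n] and at [n.+1]. *)
Lemma legendre_sqnorm n :
  \intI (fun x => (L n).[x] * (L n).[x]) = 2 / (2 * n + 1)%N%:R.
Proof.
elim: n => [|n IH].
  rewrite (@eq_intI _ _ (fun=> 1)); last by move=> x _; rewrite legendre0 !hornerE.
  by rewrite intI_cst muln0 add0n divr1 mulr1.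
pose X := \intI (fun x => x * (L n).[x] * (L n.+1).[x]).
have cX : contI (fun x : R => x * (L n).[x] * (L n.+1).[x]).
  rewrite (_ : (fun x => _) = (fun x => ('X * L n * L n.+1).[x])) //.
  by apply/funext => x; rewrite !hornerM hornerX.
have orth (j j' : nat) : j != j' -> \intI (fun x => (L j).[x] * (L j').[x]) = 0.
  exact: legendre_orthogonal.
have cLL (j j' : nat) : contI (fun x => (L j).[x] * (L j').[x]) by apply: contIM.
have cZ (c : R) (j j' : nat) : contI (fun x => c * ((L j).[x] * (L j').[x])).
  by apply: contIM.
have E1 : (2 * n + 1)%:R * X = n.+1%:R * \intI (fun x => (L n.+1).[x] * (L n.+1).[x]).
  rewrite -intIZ //.
  transitivity (\intI (fun x => n.+1%:R * ((L n.+1).[x] * (L n.+1).[x])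
                     + n%:R * ((L n.-1).[x] * (L n.+1).[x]))).
    apply: eq_intI => x _.
    transitivity (((2 * n + 1)%:R * (x * (L n).[x])) * (L n.+1).[x]); first by ring.
    by rewrite legendre_rec_horner; ring.
  by rewrite intID // !intIZ // (orth n.-1) ?mulr0 ?addr0 //; lia.
have E2 : (2 * n.+1 + 1)%:R * X = n.+1%:R * \intI (fun x => (L n).[x] * (L n).[x]).
  rewrite -intIZ //.
  transitivity (\intI (fun x => n.+1%:R * ((L n).[x] * (L n).[x])
                     + n.+2%:R * ((L n.+2).[x] * (L n).[x]))).
    apply: eq_intI => x _.
    transitivity (((2 * n.+1 + 1)%:R * (x * (L n.+1).[x])) * (L n).[x]); first by ring.
    by rewrite legendre_rec_horner /=; ring.
  by rewrite intID // !intIZ // (orth n.+2) ?mulr0 ?addr0 //; lia.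
have nz (j : nat) : j.+1%:R != 0 :> R by rewrite pnatr_eq0.
have nz1 (j : nat) : (j + 1)%:R != 0 :> R by rewrite addn1.
apply: (mulfI (nz n)); rewrite -E1.
apply: (mulfI (nz1 (2 * n.+1)%N)); rewrite mulrCA E2 IH.
field; have := ler0n R n => n0.
by apply/andP; split; apply: lt0r_neq0; lra.
Qed.

Lemma intI_legendre n m : \intI (fun x => (L n).[x] * (L m).[x])
  = if n == m then 2 / (2 * n + 1)%N%:R else 0.
Proof.
by case: eqVneq => [<-|/legendre_orthogonal//]; rewrite legendre_sqnorm.
Qed.

End LegendreOrthogonality.

(** * Pointwise decay of Legendre polynomials *)

Section LegendreDecay.
Context {R : realType}.
Local Notation L n := (@legendre R n).
Implicit Types f g : R -> R.

Let hE := (hornerD, hornerN, hornerM, horner_exp, hornerC, hornerX).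

(** For y = L n, lam = n(n+1) and p = 1 - x^2, Legendre's equation is
   (p y')' = - lam y, so E = lam p y^2 + (p y')^2 has derivative - 2 lam x y^2:
   the energy is largest at 0. *)
Let energy n : {poly R} :=
  (n * n.+1)%:R * ((1 - 'X^2) * L n ^+ 2) + ((1 - 'X^2) * (L n)^`()) ^+ 2.

Let energy_deriv n : (energy n)^`() = - (2 * (n * n.+1)%:R * ('X * L n ^+ 2)).
Proof.
have ode := legendre_ode n.
have -> : energy n = (n * n.+1)%:R * ((1 - 'X^2) * (L n * L n))
   + (('X^2 - 1) * (L n)^`()) * (('X^2 - 1) * (L n)^`()).
  by rewrite /energy; ring.
have d1 : (1 : {poly R})^`() = 0 by rewrite -polyC1 derivC.
have d2 : ('X^2 : {poly R})^`() = 2 * 'X by rewrite derivXn /= expr1 -mulr_natl.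
have d3 (j : nat) : (j%:R : {poly R})^`() = 0 by rewrite -polyC_natr derivC.
rewrite derivD [X in _ + X]derivM ode 3!derivM d3 derivB d1 d2.
ring.
Qed.

Let energy_le_at0 n x : (energy n).[x] <= (energy n).[0].
Proof.
have der (y : R) : is_derive y 1 (horner (energy n)) (energy n)^`().[y].
  apply: DeriveDef; first exact: derivable_horner.
  by rewrite derivE derive1E.
have cont (A : set R) : {within A, continuous (horner (energy n))}.
  by apply: continuous_subspaceT; exact: continuous_horner.
have slope (y : R) : (energy n)^`().[y] = - (2 * (n * n.+1)%:R * (L n).[y] ^+ 2) * y.
  by rewrite energy_deriv; move: (L n) => u; rewrite -!(polyC_natr R) !hE; ring.
have le0 (y : R) : 0 <= 2 * (n * n.+1)%:R * (L n).[y] ^+ 2.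
  by rewrite -natrM mulr_ge0 ?sqr_ge0.
rewrite -subr_le0; have [x0|/ltW x0] := leP 0 x.
- have [c cI ->] := MVT_segment x0 (fun y _ => der y) (@cont _).
  move: cI; rewrite in_itv /= slope => /andP[c0 cx].
  by rewrite subr0 !mulNr oppr_le0 mulr_ge0 ?(le_trans c0 cx) // mulr_ge0.
- rewrite -oppr_ge0 opprB.
  have [c cI ->] := MVT_segment x0 (fun y _ => der y) (@cont _).
  move: cI; rewrite in_itv /= slope => /andP[xc c0].
  by rewrite sub0r mulrN !mulNr opprK -mulrA mulr_ge0 // mulr_le0 // (le_trans xc c0).
Qed.

(** With a = L_m(0)^2 and b = L_(m+1)(0)^2 the energies at 0 of orders m and
   m+1 are m(m+1) a + (m+1)^2 b and (m+1)(m+2) b + (m+1)^2 a; hence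
   m E_(m+1) <= (m+1) E_m, which gives linear growth from E_1 = 1. *)
Let energy_at0 n : (energy n.+1).[0] <= n.+1%:R.
Proof.
have E (j : nat) : (energy j).[0] = j%:R * j.+1%:R * (L j).[0] ^+ 2
    + j.+1%:R ^+ 2 * (L j.+1).[0] ^+ 2.
  have := congr1 (fun p : {poly R} => p.[0]) (@legendre_step R j).
  rewrite /energy -!(polyC_natr R) /=.
  move: (L j.+1) (L j) => u v; rewrite !hE natrM => h.
  have {h} h : v^`().[0] = - (j.+1%:R * u.[0]) by apply: oppr_inj; rewrite opprK h; ring.
  by rewrite h; ring.
elim: n => [|n IH].
  rewrite E legendre1 hornerX.
  have := @legendre_rec_horner R 1 0; rewrite legendre0 /= hornerC => h.
  have {h} h : (L 2).[0] = - 2^-1 by lra.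
  by rewrite h; lra.
have : n.+1%:R * (energy n.+2).[0] <= n.+2%:R * (energy n.+1).[0].
  have := @legendre_rec_horner R n.+2 0.
  rewrite /= !E; move: (L n.+3) (L n.+2) (L n.+1) => u v w h.
  have {h} h : n.+3%:R * u.[0] = - (n.+2%:R * w.[0]) by lra.
  rewrite -[n.+3%:R ^+ 2 * _]exprMn h.
  rewrite -subr_ge0; set z := (X in 0 <= X).
  have -> : z = n.+2%:R * v.[0] ^+ 2 by rewrite /z; ring.
  by rewrite mulr_ge0 // sqr_ge0.
move=> h; rewrite -(ler_pM2l (ltr0Sn R n)); apply: (le_trans h).
by rewrite mulrC ler_wpM2r.
Qed.

(** L_n(x) decays like n^(-1/2) at each interior point; the kinetic part of
    the energy is dropped. *)
Lemma legendre_bound n x : n.+1%:R * (1 - x ^+ 2) * (L n).[x] ^+ 2 <= 1.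
Proof.
case: n => [|n].
  by rewrite legendre0 hornerC expr1n mulr1 mul1r gerBl sqr_ge0.
have h := le_trans (energy_le_at0 n.+1 x) (energy_at0 n).
have h2 : (energy n.+1).[x] = n.+1%:R * (n.+2%:R * (1 - x ^+ 2) * (L n.+1).[x] ^+ 2)
   + ((1 - x ^+ 2) * (L n.+1)^`().[x]) ^+ 2.
  rewrite /energy -!(polyC_natr R).
  by move: (L n.+1) => v; rewrite !hE natrM; ring.
rewrite -(ler_pM2l (ltr0Sn R n)) mulr1; apply: le_trans h.
by rewrite h2 lerDl sqr_ge0.
Qed.

End LegendreDecay.

(** * Partial sums, Bessel's inequality and the Christoffel-Darboux identity *)

Section PartialSums.
Context {R : realType}.
Local Notation L n := (@legendre R n).
Implicit Types f g : R -> R.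

Definition leg_psum f n x : R := \sum_(j < n) leg_coef f j * (L j).[x].
Definition leg_rem f n x : R := f x - leg_psum f n x.

Let odd_neq0 n : (2 * n + 1)%:R != 0 :> R.
Proof. by rewrite addn1 pnatr_eq0. Qed.

Lemma contI_psum f n : contI (leg_psum f n).
Proof. by apply: contI_sum => i _; apply: contIM. Qed.

Lemma contI_rem f n : contI f -> contI (leg_rem f n).
Proof. by move=> cf; apply: contIB => //; exact: contI_psum. Qed.

Lemma intI_leg_coef f j :
  \intI (fun x => f x * (L j).[x]) = 2 / (2 * j + 1)%:R * leg_coef f j.
Proof. by rewrite /leg_coef; field; have := odd_neq0 j; rewrite natrD natrM. Qed.

Lemma intI_psum_legendre f n j :
  \intI (fun x => leg_psum f n x * (L j).[x])
  = if (j < n)%N then 2 / (2 * j + 1)%:R * leg_coef f j else 0.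
Proof.
transitivity (\intI (fun x => \sum_(i < n) leg_coef f i * ((L i).[x] * (L j).[x]))).
  apply: eq_intI => x _; rewrite /leg_psum big_distrl /=.
  by apply: eq_bigr => i _; rewrite mulrA.
rewrite intI_sum; last by move=> i _; apply: contIM => //; exact: contIM.
transitivity (\sum_(i < n) if i == j :> nat then 2 / (2 * j + 1)%:R * leg_coef f j else 0).
  apply: eq_bigr => i _; rewrite intIZ ?intI_legendre; last exact: contIM.
  by case: eqP => [->|]; rewrite ?mulr0 // mulrC.
rewrite -big_mkcond /=; case: ltnP => [jn|nj].
  by rewrite (big_pred1 (Ordinal jn)).
by rewrite big1 // => i /eqP ij; move: (ltn_ord i); rewrite ij ltnNge nj.
Qed.

Lemma intI_rem_legendre f n j : contI f ->
  \intI (fun x => leg_rem f n x * (L j).[x])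
  = if (j < n)%N then 0 else 2 / (2 * j + 1)%:R * leg_coef f j.
Proof.
move=> cf; transitivity (\intI (fun x => f x * (L j).[x] - leg_psum f n x * (L j).[x])).
  by apply: eq_intI => x _; rewrite mulrBl.
rewrite intIB; [|by apply: contIM|by apply: contIM => //; exact: contI_psum].
by rewrite intI_leg_coef intI_psum_legendre; case: ifP; rewrite ?subrr ?subr0.
Qed.

Lemma intI_rem_sqr f n : contI f ->
  \intI (fun x => leg_rem f n x * leg_rem f n x)
  = \intI (fun x => f x * f x)
    - \sum_(j < n) 2 / (2 * j + 1)%:R * leg_coef f j ^+ 2.
Proof.
move=> cf; elim: n => [|n IH].
  rewrite big_ord0 subr0; apply: eq_intI => x _.
  by rewrite /leg_rem /leg_psum big_ord0 subr0.
rewrite big_ord_recr /= opprD addrA -IH.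
set c := leg_coef f n.
transitivity (\intI (fun x => leg_rem f n x * leg_rem f n x
   - (2 * c) * (leg_rem f n x * (L n).[x]) + c ^+ 2 * ((L n).[x] * (L n).[x]))).
  apply: eq_intI => x _; rewrite /leg_rem /leg_psum big_ord_recr /= -/c; ring.
have crem := @contI_rem f n cf.
have crr : contI (fun x => leg_rem f n x * leg_rem f n x) by apply: contIM.
have crl : contI (fun x => leg_rem f n x * (L n).[x]) by apply: contIM.
have cll : contI (fun x => (L n).[x] * (L n).[x]) by apply: contIM.
have ccrl : contI (fun x => 2 * c * (leg_rem f n x * (L n).[x])) by apply: contIM.
have ccll : contI (fun x => c ^+ 2 * ((L n).[x] * (L n).[x])) by apply: contIM.
rewrite intID //; last exact: contIB.
rewrite intIB // !intIZ // intI_rem_legendre // ltnn intI_legendre eqxx -/c.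
by ring.
Qed.

Lemma bessel f n : contI f ->
  \sum_(j < n) 2 / (2 * j + 1)%:R * leg_coef f j ^+ 2 <= \intI (fun x => f x * f x).
Proof.
move=> cf; rewrite -subr_ge0 -intI_rem_sqr //.
by apply: intI_ge0 => x _; rewrite -expr2 sqr_ge0.
Qed.

(** The first [n] terms of Bessel's inequality for [n + d] coefficients are the
    square norm lost between [f] and its remainder ([intI_rem_sqr]). *)
Lemma bessel_rem f n d : contI f ->
  \sum_(j < d) 2 / (2 * (n + j) + 1)%:R * leg_coef f (n + j) ^+ 2
  <= \intI (fun x => leg_rem f n x * leg_rem f n x).
Proof.
move=> cf; have := @bessel f (n + d) cf.
by rewrite big_split_ord /= intI_rem_sqr // lerBrDl.
Qed.

Lemma bessel_cvg f : contI f ->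
  2 / (2 * j + 1)%:R * leg_coef f j ^+ 2 @[j --> \oo] --> (0 : R).
Proof.
move=> cf; apply: cvg_series_cvg_0; apply: nondecreasing_is_cvgn.
  apply/nondecreasing_seqP => n; rewrite /series /= big_nat_recr //= lerDl.
  by rewrite mulr_ge0 ?sqr_ge0 // divr_ge0.
exists (\intI (fun x => f x * f x)) => _ [n _ <-].
by rewrite /series /= big_mkord; exact: bessel.
Qed.

(** [L n] has degree exactly n, so the leading coefficient of [p] can be
    cancelled and the degree lowered. *)
Lemma legendre_span (p : {poly R}) n : (size p <= n)%N ->
  exists c : nat -> R, p = \sum_(j < n) c j *: L j.
Proof.
elim: n p => [|n IH] p sp.
  by exists (fun=> 0); rewrite big_ord0; apply/eqP; rewrite -size_poly_leq0.
have lc0 : (L n)`_n != 0.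
  have := @size_legendre R n; rewrite -[n in _`_n]/(n.+1.-1) => <-.
  by rewrite -lead_coefE lead_coef_eq0 -size_poly_eq0 size_legendre.
pose a := p`_n / (L n)`_n.
have [|c hc] := IH (p - a *: L n).
  apply/leq_sizeP => j; rewrite leq_eqVlt => /predU1P[<-|nj].
    by rewrite coefB coefZ /a divfK // subrr.
  rewrite coefB coefZ !nth_default ?mulr0 ?subr0 ?size_legendre //.
  exact: leq_trans sp nj.
exists (fun j => if (j < n)%N then c j else a).
rewrite big_ord_recr /= ltnn -[LHS](subrK (a *: L n)) hc; congr (_ + _).
by apply: eq_bigr => i _; rewrite ltn_ord.
Qed.

Lemma legendre_expansion (p : {poly R}) n x : (size p <= n)%N ->
  p.[x] = leg_psum (horner p) n x.
Proof.
move=> /legendre_span[c pE]; rewrite {1}pE horner_sum; apply: eq_bigr => i _.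
rewrite hornerZ; congr (_ * _).
apply: (@mulfI _ (2 / (2 * i + 1)%:R)).
  by rewrite mulf_neq0 ?invr_eq0 ?odd_neq0 ?pnatr_eq0.
rewrite -intI_leg_coef.
transitivity (\intI (fun x => \sum_(j < n) c j * ((L j).[x] * (L i).[x]))).
  have cLL j : contI (fun x => (L j).[x] * (L i).[x]) by apply: contIM.
  rewrite intI_sum => [|j _]; last exact: contIM.
  rewrite (bigD1 i) //= big1 => [|j ji].
    by rewrite addr0 intIZ // intI_legendre eqxx mulrC.
  by rewrite intIZ // intI_legendre ifN ?mulr0.
apply: eq_intI => y _; rewrite pE horner_sum big_distrl /=.
by apply: eq_bigr => j _; rewrite (hornerZ (c j)) mulrA.
Qed.

(** The Christoffel-Darboux identity, multiplied by [t - x] so that it stays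
    polynomial: the recurrence makes the sum telescope. *)
Lemma christoffel_darboux n x t :
  \sum_(j < n.+1) (2 * j + 1)%:R * (L j).[x] * (L j).[t] * (t - x)
  = n.+1%:R * ((L n.+1).[t] * (L n).[x] - (L n).[t] * (L n.+1).[x]).
Proof.
elim: n => [|n IH].
  by rewrite big_ord_recr big_ord0 /= legendre0 legendre1 !hornerC !hornerX; ring.
rewrite big_ord_recr /= IH.
transitivity (n.+1%:R * ((L n.+1).[t] * (L n).[x] - (L n).[t] * (L n.+1).[x])
  + ((2 * n.+1 + 1)%:R * (t * (L n.+1).[t])) * (L n.+1).[x]
  - ((2 * n.+1 + 1)%:R * (x * (L n.+1).[x])) * (L n.+1).[t]); first by ring.
by rewrite !legendre_rec_horner /=; ring.
Qed.

End PartialSums.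

(** * Pointwise convergence of Legendre series *)

Section Convergence.
Context {R : realType}.
Local Notation L n := (@legendre R n).
Implicit Types f g h : R -> R.

(** The regularity that the class C^m provides for the derivatives of order
    less than m: differentiability at each point of [-1,1], one-sided at the
    ends. *)
Definition diffI f : Prop :=
  forall x : R, x \in II -> cvg (dquot f x y @[y --> within II (x^')]).

Lemma cvg_punctured h (x : R) : h y @[y --> within II (x^')] --> h x ->
  h y @[y --> within II (nbhs x)] --> h x.
Proof.
move=> hx A Ax.
(* Restricting a punctured neighborhood filter to [-1,1] means this. *)
have hA : nbhs x (fun y => y != x -> II y -> A (h y)) by exact: hx Ax.
rewrite /= nbhs_simpl /within /=; apply: filterS hA => y yA yI /=.
have [->|h1] := eqVneq y x; first exact: (nbhs_singleton Ax).
exact: yA h1 yI.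
Qed.

Lemma diffI_slope f (x : R) : diffI f -> x \in II ->
  exists g, g y @[y --> within II (nbhs x)] --> g x /\
    forall t, f t = f x + g t * (t - x).
Proof.
move=> df xI; pose g t := if t == x then lim (dquot f x y @[y --> within II (x^')])
  else dquot f x t.
exists g; split=> [|t]; last first.
  rewrite /g; have [->|tx] := eqVneq t x; first by rewrite subrr mulr0 addr0.
  by rewrite /dquot divfK ?subr_eq0 // addrC subrK.
apply: cvg_punctured; rewrite {2}/g eqxx.
move=> A AL.
have hA : nbhs x (fun y => y != x -> II y -> A (dquot f x y)) by exact: df xI A AL.
have : nbhs x (fun y => y != x -> II y -> A (g y)); last exact: id.
by apply: filterS hA => y yA yx yI; rewrite /g (negbTE yx); exact: yA.
Qed.

Lemma diffI_contI f : diffI f -> contI f.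
Proof.
move=> df; apply/contIP => x xI.
have [g [gx fE]] := diffI_slope df xI.
have : f x + g y * (y - x) @[y --> within II (nbhs x)] --> f x + g x * (x - x).
  apply: cvgD; first exact: cvg_cst.
  apply: cvgM => //; apply: cvgB; last exact: cvg_cst.
  by apply: cvg_within_filter; exact: cvg_id.
by rewrite -fE (_ : (fun y => f x + g y * (y - x)) = f) //; apply/funext.
Qed.

(** Difference quotients at a fixed point extend to a continuous function, to
    which Bessel's inequality applies. *)
Lemma diffI_factor f (x : R) : diffI f -> x \in II ->
  exists2 g, contI g & forall t, f t = f x + g t * (t - x).
Proof.
move=> df xI; have [g [gx fE]] := diffI_slope df xI; exists g => //.
apply/contIP => y yI; have [->//|yx] := eqVneq y x.
have cf := (contIP f).1 (diffI_contI df) y yI.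
have gE t : t != x -> g t = (f t - f x) / (t - x).
  by move=> tx; rewrite fE addrC addKr mulfK // subr_eq0.
rewrite gE //.
have quot : (f t - f x) / (t - x) @[t --> within II (nbhs y)]
    --> (f y - f x) / (y - x).
  apply: cvgM; first by apply: cvgB => //; exact: cvg_cst.
  apply: cvgV; first by rewrite subr_eq0.
  apply: cvgB; last exact: cvg_cst.
  by apply: cvg_within_filter; exact: cvg_id.
move=> A Ay.
have hA : nbhs y (fun t => II t -> A ((f t - f x) / (t - x))) by exact: quot A Ay.
have nx : nbhs y (fun t => t != x) by apply: open_nbhs_nbhs; split => //; exact: open_neq.
have : nbhs y (fun t => II t -> A (g t)); last exact: id.
by apply: filterS2 hA nx => t tA tx tI; rewrite gE //; exact: tA.
Qed.

(** The constant f(x) equals its own partial sum, so only the part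
    g(t) (t - x) of [f] contributes to the error, and the factor t - x is what
    the Christoffel-Darboux identity absorbs. *)
Lemma psum_error f (x : R) g n : contI g -> (forall t, f t = f x + g t * (t - x)) ->
  leg_psum f n.+1 x - f x
  = n.+1%:R * (leg_coef g n.+1 * (L n).[x] / (2 * n.+1 + 1)%:R
               - leg_coef g n * (L n.+1).[x] / (2 * n + 1)%:R).
Proof.
move=> cg fE.
have fxE : f x = leg_psum (horner (f x)%:P) n.+1 x.
  rewrite -legendre_expansion ?hornerC //.
  by rewrite (leq_trans (size_polyC_leq1 _)).
have cgx j : contI (fun t => g t * (t - x) * (L j).[t]).
  apply: contIM => //; apply: contIM => //.
  rewrite (_ : (fun t => t - x) = (fun t => ('X - x%:P).[t])) //.
  by apply/funext => t; rewrite !hornerE.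
transitivity (\sum_(j < n.+1) (2 * j + 1)%:R / 2 *
    \intI (fun t => g t * (t - x) * (L j).[t]) * (L j).[x]).
  rewrite {1}fxE /leg_psum -sumrB; apply: eq_bigr => j _.
  rewrite -mulrBl /leg_coef -mulrBr; congr (_ * _ * _).
  have cLj : contI (fun t => (f x)%:P.[t] * (L j).[t]) by apply: contIM.
  have -> : \intI (fun t => f t * (L j).[t]) = \intI (fun t =>
      (f x)%:P.[t] * (L j).[t] + g t * (t - x) * (L j).[t]).
    by apply: eq_intI => t _; rewrite fE hornerC; ring.
  by rewrite intID // addrC addKr.
transitivity (\intI (fun t => (n.+1%:R / 2 * (L n).[x]) * (g t * (L n.+1).[t])
   - (n.+1%:R / 2 * (L n.+1).[x]) * (g t * (L n).[t]))).
  transitivity (\intI (fun t => \sum_(j < n.+1)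
      ((2 * j + 1)%:R / 2 * (L j).[x]) * (g t * (t - x) * (L j).[t]))).
    rewrite intI_sum; last by move=> j _; apply: contIM.
    by apply: eq_bigr => j _; rewrite intIZ //; ring.
  apply: eq_intI => t _.
  transitivity (g t / 2 * \sum_(j < n.+1)
      (2 * j + 1)%:R * (L j).[x] * (L j).[t] * (t - x)).
    by rewrite big_distrr /=; apply: eq_bigr => j _; ring.
  by rewrite christoffel_darboux; ring.
have cgL j : contI (fun t => g t * (L j).[t]) by apply: contIM.
rewrite intIB ?intIZ //; try exact: contIM.
rewrite !intI_leg_coef; field.
by have := ler0n R n => n0; apply/andP; split; apply: lt0r_neq0; lra.
Qed.

(** By [psum_error] and [legendre_bound] the square of the error at x is at
    most (1 - x^2)^(-1) (u_(n+1) + u_n), where u is the general term of the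
    convergent series of Bessel's inequality for the difference quotient. *)
Lemma legendre_series_cvg f (x : R) : diffI f -> -1 < x < 1 ->
  leg_psum f n x @[n --> \oo] --> f x.
Proof.
move=> df /andP[x1 x2].
have xI : x \in II by rewrite inE /= in_itv /= !ltW.
have [g cg fE] := diffI_factor df xI.
pose u j := 2 / (2 * j + 1)%:R * leg_coef g j ^+ 2.
have u0 : u j @[j --> \oo] --> (0 : R) by exact: bessel_cvg.
have p0 : 0 < 1 - x ^+ 2 by nra.
pose v n := (1 - x ^+ 2)^-1 * (u n.+1 + u n).
have u1 : u n.+1 @[n --> \oo] --> (0 : R).
  by have := cvg_shiftS u (nbhs (0 : R)); rewrite /= => ->.
have v0 : v n @[n --> \oo] --> (1 - x ^+ 2)^-1 * (0 + 0).
  by apply: cvgM; [exact: cvg_cst|exact: cvgD].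
rewrite addr0 mulr0 in v0.
have err n : (leg_psum f n.+1 x - f x) ^+ 2 <= v n.
  rewrite (psum_error _ cg fE) /v ler_pdivlMl // /u.
  have term (N : nat) (o a b : R) : N.+1%:R <= o -> N.+1%:R * (1 - x ^+ 2) * b ^+ 2 <= 1 ->
      (1 - x ^+ 2) * (N.+1%:R * (a * b / o)) ^+ 2 <= o^-1 * a ^+ 2.
    move=> No h; have o0 : 0 < o by apply: lt_le_trans No.
    have -> : (1 - x ^+ 2) * (N.+1%:R * (a * b / o)) ^+ 2
        = (N.+1%:R * (1 - x ^+ 2) * b ^+ 2) * (N.+1%:R / o) * (o^-1 * a ^+ 2).
      by field; rewrite gt_eqF.
    rewrite ler_piMl //; first by rewrite mulr_ge0 ?sqr_ge0 // invr_ge0 ltW.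
    rewrite mulr_ile1 //; last by rewrite ler_pdivrMr ?mul1r.
    - by rewrite mulr_ge0 ?sqr_ge0 // mulr_ge0 // ltW.
    - by rewrite divr_ge0 // ltW.
  have le1 : n.+1%:R <= (2 * n.+1 + 1)%:R :> R by rewrite ler_nat; lia.
  have le2 : n.+1%:R <= (2 * n + 1)%:R :> R by rewrite ler_nat; lia.
  have t1 := term n _ (leg_coef g n.+1) (L n).[x] le1 (legendre_bound n x).
  have b : n.+1%:R * (1 - x ^+ 2) * (L n.+1).[x] ^+ 2 <= 1.
    apply: le_trans (legendre_bound n.+1 x).
    by rewrite -!mulrA ler_wpM2r ?ler_nat // mulr_ge0 ?sqr_ge0 // ltW.
  have t2 := term n _ (leg_coef g n) (L n.+1).[x] le2 b.
  move: t1 t2; rewrite mulrBr.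
  set X := _ * (_ / _); set Y := _ * (_ / _) => t1 t2.
  have XY : (1 - x ^+ 2) * (X - Y) ^+ 2
      <= 2 * ((1 - x ^+ 2) * X ^+ 2) + 2 * ((1 - x ^+ 2) * Y ^+ 2).
    rewrite -subr_ge0 (_ : _ - _ = (1 - x ^+ 2) * (X + Y) ^+ 2); last by ring.
    by rewrite mulr_ge0 ?sqr_ge0 // ltW.
  apply: le_trans XY _; rewrite -!mulrA lerD // ler_pM2l //.
rewrite -(cvg_shiftS (fun n => leg_psum f n x)) /=.
apply/cvgrPdist_lt => e e0.
have e20 : 0 < e ^+ 2 by rewrite exprn_gt0.
move/cvgrPdist_lt/(_ _ e20) : v0; apply: filterS => n.
rewrite sub0r normrN => h.
rewrite distrC -(ltr_pXn2r (_ : 0 < 2)%N) ?nnegrE ?(ltW e0) // real_normK ?num_real //.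
apply: le_lt_trans (err n) _; apply: le_lt_trans h; exact: ler_norm.
Qed.

Lemma leg_tailE f i (x : R) : diffI f -> -1 < x < 1 ->
  leg_tail f i x = leg_rem f i.+1 x.
Proof.
move=> df xI; apply: cvg_lim => //.
have := @legendre_series_cvg f x df xI.
(* The maximum matters only for K <= i, where the tail sum is empty. *)
have -> : (fun K => \sum_(i.+1 <= n < K) leg_coef f n * (L n).[x])
  = fun K => leg_psum f (maxn K i.+1) x - leg_psum f i.+1 x.
  apply/funext => K.
  rewrite /leg_psum -!(big_mkord xpredT (fun n => leg_coef f n * (L n).[x])).
  have [Ki|iK] := leqP K i.+1.
    by rewrite subrr big_geq.
  by rewrite (big_cat_nat (leq0n i.+1) (ltnW iK)) //= [RHS]addrC addKr.
move=> h; rewrite /leg_rem; apply: cvgB; last exact: cvg_cst.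
apply: cvg_trans h; apply: near_eq_cvg; near=> K.
by rewrite (maxn_idPl _) //; near: K; exact: nbhs_infty_ge.
Unshelve. all: by end_near. Qed.

End Convergence.

(** * Splitting integrals of products along Legendre expansions *)

Section Splitting.
Context {R : realType}.
Local Notation L n := (@legendre R n).
Implicit Types f g u : R -> R.

Lemma intI_mul_tail u g n : contI u -> diffI g ->
  \intI (fun x => u x * leg_tail g n x) = \intI (fun x => u x * leg_rem g n.+1 x).
Proof.
move=> cu dg; apply: eq_intI_interior => [|x xI]; last by rewrite leg_tailE.
by apply: contIM => //; apply: contI_rem; exact: diffI_contI.
Qed.

Lemma intI_mul_psum u f n : contI u ->
  \intI (fun x => u x * leg_psum f n x)
  = \sum_(i < n) leg_coef f i * \intI (fun x => u x * (L i).[x]).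
Proof.
move=> cu; have cuL i : contI (fun x => u x * (L i).[x]) by apply: contIM.
transitivity (\intI (fun x => \sum_(i < n) leg_coef f i * (u x * (L i).[x]))).
  by apply: eq_intI => x _; rewrite big_distrr; apply: eq_bigr => i _; rewrite mulrCA.
rewrite intI_sum => [|i _]; last exact: contIM.
by apply: eq_bigr => i _; rewrite intIZ.
Qed.

(** Each factor is its partial sum plus its tail.  An entry of the functional
    is the case where [f] and [g] are derivatives of the components of w and
    the cutoffs are N_alpha and N_beta. *)
Lemma intI_product_split (p : {poly R}) f g n1 n2 : diffI f -> diffI g ->
  \intI (fun x => p.[x] * f x * g x) =
  \sum_(i < n1.+1) \sum_(j < n2.+1) leg_coef f i * leg_coef g j *
    \intI (fun x => p.[x] * (L i).[x] * (L j).[x])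
  + (\sum_(i < n1.+1) leg_coef f i *
       \intI (fun x => p.[x] * (L i).[x] * leg_tail g n2 x)
     + \sum_(j < n2.+1) leg_coef g j *
       \intI (fun x => p.[x] * (L j).[x] * leg_tail f n1 x))
  + \intI (fun x => p.[x] * leg_tail f n1 x * leg_tail g n2 x).
Proof.
move=> df dg; have cf := diffI_contI df; have cg := diffI_contI dg.
set S1 := leg_psum f n1.+1; set S2 := leg_psum g n2.+1.
set W1 := leg_rem f n1.+1; set W2 := leg_rem g n2.+1.
have cS1 : contI S1 by exact: contI_psum.
have cS2 : contI S2 by exact: contI_psum.
have cW1 : contI W1 by exact: contI_rem.
have cW2 : contI W2 by exact: contI_rem.
have cpm h : contI h -> contI (fun x => p.[x] * h x) by move=> ?; apply: contIM.
have cpL i : contI (fun x => p.[x] * (L i).[x]) by exact: cpm.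
have -> : \sum_(i < n1.+1) \sum_(j < n2.+1) leg_coef f i * leg_coef g j *
    \intI (fun x => p.[x] * (L i).[x] * (L j).[x]) = \intI (fun x => p.[x] * S2 x * S1 x).
  rewrite intI_mul_psum; last exact: cpm.
  apply: eq_bigr => i _.
  transitivity (leg_coef f i * \intI (fun x => p.[x] * (L i).[x] * S2 x)).
    rewrite intI_mul_psum // big_distrr /=.
    by apply: eq_bigr => j _; rewrite mulrA.
  by congr (_ * _); apply: eq_intI => x _; ring.
have -> : \sum_(i < n1.+1) leg_coef f i *
    \intI (fun x => p.[x] * (L i).[x] * leg_tail g n2 x) = \intI (fun x => p.[x] * W2 x * S1 x).
  rewrite intI_mul_psum; last exact: cpm.
  apply: eq_bigr => i _; rewrite intI_mul_tail //.
  by congr (_ * _); apply: eq_intI => x _; rewrite -/W2; ring.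
have -> : \sum_(j < n2.+1) leg_coef g j *
    \intI (fun x => p.[x] * (L j).[x] * leg_tail f n1 x) = \intI (fun x => p.[x] * W1 x * S2 x).
  rewrite intI_mul_psum; last exact: cpm.
  apply: eq_bigr => i _; rewrite intI_mul_tail //.
  by congr (_ * _); apply: eq_intI => x _; rewrite -/W1; ring.
have -> : \intI (fun x => p.[x] * leg_tail f n1 x * leg_tail g n2 x)
    = \intI (fun x => p.[x] * W1 x * W2 x).
  apply: eq_intI_interior => [|x xI]; last by rewrite !leg_tailE.
  by apply: contIM => //; exact: cpm.
have c2 h1 h2 : contI h1 -> contI h2 -> contI (fun x => p.[x] * h1 x * h2 x).
  by move=> ? ?; apply: contIM => //; exact: cpm.
have c21 := c2 _ _ cS2 cS1; have c31 := c2 _ _ cW2 cS1.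
have c12 := c2 _ _ cW1 cS2; have c33 := c2 _ _ cW1 cW2.
rewrite -(intID c31 c12) -intID //; last exact: contID.
rewrite -intID //; last by apply: contID => //; exact: contID.
by apply: eq_intI => x _; rewrite /W1 /W2 /leg_rem -/S1 -/S2; ring.
Qed.

(** In the Legendre expansion of [q], the terms of index less than [n] are
    orthogonal to the remainder, and at most [d] others are left. *)
Lemma intI_poly_rem (q : {poly R}) g n d : contI g -> (size q <= n + d)%N ->
  \intI (fun x => q.[x] * leg_rem g n x)
  = \sum_(j < d) \intI (fun x => q.[x] * (L (n + j)).[x]) * leg_coef g (n + j).
Proof.
move=> cg sq; have crem := @contI_rem _ g n cg.
have -> : \intI (fun x => q.[x] * leg_rem g n x)
    = \intI (fun x => leg_rem g n x * leg_psum (horner q) (n + d) x).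
  by apply: eq_intI => x _; rewrite -legendre_expansion // mulrC.
rewrite intI_mul_psum // big_split_ord /= big1 ?add0r => [|i _]; last first.
  by rewrite intI_rem_legendre // ltn_ord mulr0.
apply: eq_bigr => i _.
rewrite intI_rem_legendre // ltnNge leq_addr /=.
by rewrite (intI_leg_coef (horner q)); ring.
Qed.

(** A product of [p], of degree at most [d], with [L i] meets the remainder
    only if i > M - d, and then only in its first [d] coefficients.  This makes
    the leading cross term a finite bilinear form. *)
Lemma mixed_sum (p : {poly R}) g (c : nat -> R) M d : contI g ->
  (size p <= d.+1)%N -> (d <= M)%N ->
  \sum_(i < M.+1) c i * \intI (fun x => p.[x] * (L i).[x] * leg_rem g M.+1 x)
  = \sum_(i < d) \sum_(j < d) c (M - d + i.+1)%N *
      \intI (fun x => p.[x] * (L (M - d + i.+1)).[x] * (L (M + j.+1)).[x]) *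
      leg_coef g (M + j.+1).
Proof.
move=> cg sp dM.
have spL i : (size (p * L i)%R <= d + i.+1)%N.
  apply: leq_trans (size_polyMleq _ _) _; rewrite size_legendre.
  by move: (size p) sp => sz; lia.
have pLE i h : \intI (fun x => p.[x] * (L i).[x] * h x) = \intI (fun x => (p * L i).[x] * h x).
  by apply: eq_intI => x _; rewrite hornerM.
rewrite -(big_mkord xpredT (fun i => c i * \intI (fun x => p.[x] * (L i).[x] * leg_rem g M.+1 x))).
rewrite (@big_cat_nat _ _ _ (M.+1 - d)) //=; last exact: leq_subr.
rewrite big_nat big1 ?add0r => [|i /andP[_ iM]]; last first.
  rewrite pLE (@intI_poly_rem _ _ _ 0) // ?big_ord0 ?mulr0 //.
  by rewrite addn0; apply: leq_trans (spL i) _; lia.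
rewrite -{1}[(M.+1 - d)%N]add0n big_addn (_ : M.+1 - (M.+1 - d) = d)%N; last by lia.
rewrite big_mkord; apply: eq_bigr => i _.
have -> : (i + (M.+1 - d) = M - d + i.+1)%N by lia.
rewrite pLE (@intI_poly_rem _ _ _ d) //; last first.
  by apply: leq_trans (spL _) _; move: (ltn_ord i); lia.
rewrite big_distrr /=; apply: eq_bigr => j _.
by rewrite addSnnS -pLE mulrA.
Qed.

End Splitting.

(** * Quadratic forms, sums of squares and null spaces *)

Section QuadraticForms.
Context {R : realType}.

Definition bform {m n : nat} (u : 'cV[R]_m) (A : 'M[R]_(m, n)) (v : 'cV[R]_n) : R :=
  (u^T *m A *m v) 0 0.

Lemma bformE m n (u : 'cV[R]_m) (A : 'M[R]_(m, n)) (v : 'cV[R]_n) :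
  bform u A v = \sum_i \sum_j u i 0 * A i j * v j 0.
Proof.
rewrite /bform mxE exchange_big /=; apply: eq_bigr => j _.
by rewrite mxE big_distrl; apply: eq_bigr => i _; rewrite mxE.
Qed.

Lemma qformE n (A : 'M[R]_n) (v : 'cV[R]_n) :
  qform A v = \sum_i \sum_j v i 0 * A i j * v j 0.
Proof. exact: bformE. Qed.

Lemma bform_tr m n (u : 'cV[R]_m) (A : 'M[R]_(m, n)) (v : 'cV[R]_n) :
  bform v A^T u = bform u A v.
Proof.
rewrite !bformE exchange_big /=; apply: eq_bigr => i _; apply: eq_bigr => j _.
by rewrite mxE; ring.
Qed.

Lemma bformZ m n (c : R) (u : 'cV[R]_m) (A : 'M[R]_(m, n)) (v : 'cV[R]_n) :
  bform u (c *: A) v = c * bform u A v.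
Proof. by rewrite /bform -scalemxAr -scalemxAl mxE. Qed.

Lemma bform0 m n (u : 'cV[R]_m) (v : 'cV[R]_n) : bform u 0 v = 0.
Proof. by rewrite /bform mulmx0 mul0mx mxE. Qed.

Lemma bform_block m1 m2 n1 n2 (u1 : 'cV[R]_m1) (u2 : 'cV[R]_m2)
    (A : 'M[R]_(m1, n1)) (B : 'M[R]_(m1, n2)) (C : 'M[R]_(m2, n1)) (D : 'M[R]_(m2, n2))
    (v1 : 'cV[R]_n1) (v2 : 'cV[R]_n2) :
  bform (col_mx u1 u2) (block_mx A B C D) (col_mx v1 v2)
  = bform u1 A v1 + bform u1 B v2 + bform u2 C v1 + bform u2 D v2.
Proof.
rewrite /bform tr_col_mx mul_row_block mul_row_col !mulmxDl !mxE.
by ring.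
Qed.

Lemma qformD n (A B : 'M[R]_n) v : qform (A + B) v = qform A v + qform B v.
Proof. by rewrite /qform mulmxDr mulmxDl mxE. Qed.

Lemma qformZ n (c : R) (A : 'M[R]_n) v : qform (c *: A) v = c * qform A v.
Proof. exact: bformZ. Qed.

Lemma qformB n (A B : 'M[R]_n) v : qform (A - B) v = qform A v - qform B v.
Proof. by rewrite -scaleN1r qformD qformZ mulN1r. Qed.

Lemma qform0 n (v : 'cV[R]_n) : qform 0 v = 0.
Proof. exact: bform0. Qed.

Lemma qform_sum n (I : Type) (r : seq I) (Pr : pred I) (A : I -> 'M[R]_n) v :
  qform (\sum_(i <- r | Pr i) A i) v = \sum_(i <- r | Pr i) qform (A i) v.
Proof.
by apply: (big_morph (fun A => qform A v)) => [B C|]; [exact: qformD|exact: qform0].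
Qed.

Lemma qform_congr m n (A : 'M[R]_m) (B : 'M[R]_(m, n)) v :
  qform (B^T *m A *m B) v = qform A (B *m v).
Proof. by rewrite /qform trmx_mul !mulmxA. Qed.

Lemma qform_diag2 (A : 'M[R]_2) (v : 'cV[R]_2) : is_diag A ->
  qform A v = A 0 0 * v 0 0 ^+ 2 + A 1 1 * v 1 0 ^+ 2.
Proof.
move=> dA; rewrite qformE !big_ord_recl !big_ord0 /=.
have e1 : lift ord0 ord0 = 1 :> 'I_2 by apply/val_inj.
rewrite e1 (_ : ord0 = 0) //; rewrite (dA 0 1) // (dA 1 0) //; ring.
Qed.

Lemma is_sos_horner (p : {poly {poly {poly R}}}) (x y z : R) :
  is_sos p -> 0 <= p.[z%:P%:P].[y%:P].[x].
Proof.
move=> [qs ->]; rewrite !horner_sum; apply: sumr_ge0 => q _.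
by rewrite !horner_exp sqr_ge0.
Qed.

(** The second component of z is the outermost variable, so it is substituted
    first. *)
Lemma zTz_horner (T : 'M[{poly R}]_2) (v : 'cV[R]_2) (x : R) :
  (zTz T).[(v 1 0)%:P%:P].[(v 0 0)%:P].[x]
  = qform (map_mx (fun q : {poly R} => q.[x]) T) v.
Proof.
rewrite qformE /zTz !horner_sum; apply: eq_bigr => a _.
rewrite !horner_sum; apply: eq_bigr => b _.
rewrite mxE !hornerM !hornerC.
have zv (c : 'I_2) : (zvar c).[(v 1 0)%:P%:P].[(v 0 0)%:P].[x] = v c 0.
  rewrite /zvar; case: eqVneq => [->|c0]; first by rewrite !(hornerC, hornerX).
  rewrite !(hornerC, hornerX); congr (v _ 0); apply/val_inj.
  by case: c c0 => -[|[|//]] //= ?.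
by rewrite !zv.
Qed.

(** On [-1,1] the weight 1 - x^2 is nonnegative, so that
    A - B = (sum of squares) + (1 - x^2) T is a sum of two nonnegative forms. *)
Lemma sos_certificate (A : 'M[{poly R}]_2) (B : 'M[R]_2) (T : 'M[{poly R}]_2) (x : R) v :
  -1 <= x <= 1 ->
  is_sos (zTz (A - map_mx polyC B - (1 - 'X^2) *: T)) -> is_sos (zTz T) ->
  0 <= qform (map_mx (fun q : {poly R} => q.[x]) A - B) v.
Proof.
move=> /andP[x1 x2] /(@is_sos_horner _ x (v 0 0) (v 1 0)).
rewrite zTz_horner => h1 /(@is_sos_horner _ x (v 0 0) (v 1 0)).
rewrite zTz_horner => h2.
set Ax := map_mx _ A; set Tx := map_mx _ T in h2.
have E : map_mx (fun q : {poly R} => q.[x]) (A - map_mx polyC B - (1 - 'X^2) *: T)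
    = Ax - B - (1 - x ^+ 2) *: Tx.
  by apply/matrixP => i j; rewrite !mxE !hornerE.
move: h1; rewrite E qformB qformZ subr_ge0; apply: le_trans.
by rewrite mulr_ge0 //; nra.
Qed.

Lemma null_basis_state m n p q (K : 'M[R]_(p, m + n)) (La : 'M[R]_(m + n, q))
    (u : 'cV[R]_m) (v : 'cV[R]_n) :
  null_basis K La -> K *m col_mx u v = 0 -> exists zeta, u = usubmx La *m zeta.
Proof.
move=> [_ /(_ (col_mx u v)) h] /h[zeta E]; exists zeta.
by rewrite mul_usub_mx -E col_mxKu.
Qed.

End QuadraticForms.

(** * The functional as a sum over pairs of derivatives *)

Section StateSums.
Context {R : realType}.

Lemma sum_pos k (F : 'I_(k.+1 + k.+1) -> R) :
  \sum_i F i = \sum_(a < 2) \sum_(al < k.+1) F (pos a al).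
Proof.
rewrite big_split_ord /= !big_ord_recl big_ord0 addr0 /=.
by congr (_ + _).
Qed.

Lemma Dvec_pos k (w : 'I_2 -> R -> R) x (a : 'I_2) (al : 'I_k.+1) :
  Dvec w 0 k.+1 x (pos a al) 0 = pderiv al (w a) x.
Proof.
rewrite /Dvec /pos; case: eqVneq => [->|a0]; first by rewrite col_mxEu mxE.
rewrite col_mxEd mxE; congr (pderiv _ (w _) x); apply/val_inj.
by case: a a0 => -[|[|//]] //= ?.
Qed.

Lemma Cm_diffI m k (w : 'I_2 -> R -> R) (a : 'I_2) : (k < m)%N -> Cm m w ->
  diffI (pderiv k (w a)).
Proof. by move=> km /(_ a)[h _]; exact: h. Qed.

Lemma Fcal_split m k N M (G : 'M[{poly R}]_(k.+1 + k.+1)) w :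
  (k < m)%N -> Cm m w ->
  Fcal G w = \sum_(a < 2) \sum_(b < 2) \sum_(ab : 'I_k.+1 * 'I_k.+1)
    (Pcal N M G w a b ab.1 ab.2 + Qcal N M G w a b ab.1 ab.2
     + Rcal N M G w a b ab.1 ab.2).
Proof.
move=> km Cw.
have dw (a : 'I_2) (al : 'I_k.+1) : diffI (pderiv al (w a)).
  by apply: (@Cm_diffI m al w a _ Cw); apply: leq_ltn_trans km; rewrite -ltnS.
have cw a al := diffI_contI (dw a al).
pose I a b (ab : 'I_k.+1 * 'I_k.+1) x :=
  (fent G a b ab.1 ab.2).[x] * pderiv ab.1 (w a) x * pderiv ab.2 (w b) x.
have cI a b ab : contI (I a b ab) by apply: contIM => //; exact: contIM.
transitivity (\intI (fun x => \sum_(a < 2) \sum_(b < 2) \sum_ab I a b ab x)).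
  apply: eq_intI => x _; rewrite qformE sum_pos; apply: eq_bigr => a _.
  under eq_bigr do rewrite sum_pos.
  rewrite exchange_big /=; apply: eq_bigr => b _.
  rewrite pair_bigA /=; apply: eq_bigr => ab _.
  by rewrite !Dvec_pos mxE /I /fent; ring.
rewrite intI_sum => [|a _]; last by do 2 (apply: contI_sum => ? _).
apply: eq_bigr => a _.
rewrite intI_sum => [|b _]; last exact: contI_sum.
apply: eq_bigr => b _; rewrite intI_sum //.
by apply: eq_bigr => -[al be] _; exact: intI_product_split.
Qed.

End StateSums.

(** * The leading block and the matrices Omega *)

Section LeadingBlock.
Context {R : realType}.
Implicit Types (f : 'I_2 -> R -> R).

Definition rem_vec f M x : 'cV[R]_2 := \col_a leg_rem (f a) M.+1 x.

Definition next_coefs f M d (a : 'I_2) : 'cV[R]_d :=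
  \col_(j < d) leg_coef (f a) (M + j.+1).

Lemma contI_qform_rem_vec f M (A : R -> 'M[R]_2) : (forall a, contI (f a)) ->
  (forall a b, contI (fun x => A x a b)) ->
  contI (fun x => qform (A x) (rem_vec f M x)).
Proof.
move=> cf cA.
rewrite (_ : (fun x => _) = (fun x => \sum_a \sum_b
    leg_rem (f a) M.+1 x * A x a b * leg_rem (f b) M.+1 x)); last first.
  apply/funext => x; rewrite qformE; apply: eq_bigr => a _; apply: eq_bigr => b _.
  by rewrite !mxE.
apply: contI_sum => a _; apply: contI_sum => b _.
by apply: contIM; [apply: contIM => //|]; exact: contI_rem.
Qed.

Lemma kron2_form n (S : 'M[R]_2) (D : 'M[R]_n) (u0 u1 : 'cV[R]_n) : is_diag S ->
  qform (kron2 S D) (col_mx u0 u1) = S 0 0 * bform u0 D u0 + S 1 1 * bform u1 D u1.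
Proof.
move=> dS; rewrite -[LHS]/(bform _ _ _) /kron2 bform_block !bformZ.
by rewrite (dS 0 1) // (dS 1 0) //; ring.
Qed.

Lemma Delta_form M d (u : 'cV[R]_d) :
  bform u (Delta M d) u = \sum_(j < d) 2 / (2 * (M + j.+1) + 1)%:R * u j 0 ^+ 2.
Proof.
rewrite bformE; apply: eq_bigr => i _; rewrite (bigD1 i) //= big1 ?addr0 => [|j ji].
  by rewrite /Delta !mxE eqxx mulr1n; ring.
by rewrite /Delta !mxE eq_sym (negbTE ji) mulr0n mulr0 mul0r.
Qed.

(** The entries of Delta are the squared norms of the Legendre polynomials of
    indices M+1, ..., M+d, which makes this Bessel's inequality. *)
Lemma Delta_next_coefs_le f M d a : (forall a, contI (f a)) ->
  bform (next_coefs f M d a) (Delta M d) (next_coefs f M d a)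
  <= \intI (fun x => leg_rem (f a) M.+1 x * leg_rem (f a) M.+1 x).
Proof.
move=> cf; rewrite Delta_form; apply: le_trans (bessel_rem M.+1 d (cf a)).
rewrite le_eqVlt; apply/orP; left; apply/eqP; apply: eq_bigr => j _.
by rewrite mxE addSnnS.
Qed.

Lemma Omega_form M d Q S (Y : 'M[R]_(d + d)) (e g : 'cV[R]_(d + d)) :
  qform (Omega M Q S Y) (col_mx e g)
  = qform Q e + 2 * bform e Y g + qform (kron2 S (Delta M d)) g.
Proof.
rewrite -[LHS]/(bform _ _ _) /Omega bform_block bform_tr.
by rewrite -!/(bform _ _ _) /qform -!/(bform _ _ _); ring.
Qed.

(** For [d = 0] this fails, since the matrix Omega is then empty and puts no
    constraint on [S]; the case is treated apart below. *)
Lemma Omega_diag_ge0 M d Q S (Y : 'M[R]_(d + d)) : (0 < d)%N -> is_diag S ->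
  (forall v, 0 <= qform (Omega M Q S Y) v) -> 0 <= S 0 0 /\ 0 <= S 1 1.
Proof.
move=> d0 dS h.
pose u : 'cV[R]_d := const_mx 1.
have pos : 0 < bform u (Delta M d) u.
  rewrite Delta_form; case: d d0 {h Y Q} @u => // d _ u.
  rewrite big_ord_recl ltr_pwDl //.
    by rewrite mxE expr1n mulr1 divr_gt0 // addn1 ltr0Sn.
  by apply: sumr_ge0 => j _; rewrite mulr_ge0 ?sqr_ge0 // divr_ge0.
have z0 (c : 'cV[R]_(d + d)) : bform 0 Y c = 0 by rewrite /bform trmx0 !mul0mx mxE.
have q0 n (A : 'M[R]_n) : qform A 0 = 0 by rewrite /qform mulmx0 mxE.
have b0 n (A : 'M[R]_n) : bform 0 A 0 = 0 := q0 n A.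
split.
- have := h (col_mx 0 (col_mx u 0)).
  rewrite Omega_form z0 q0 kron2_form // b0 !(mulr0, addr0, add0r).
  by rewrite pmulr_lge0.
- have := h (col_mx 0 (col_mx 0 u)).
  rewrite Omega_form z0 q0 kron2_form // b0 !(mulr0, addr0, add0r).
  by rewrite pmulr_lge0.
Qed.

(** The cross term is traded for a form in [e] and one in the remainder by
    evaluating Omega at the vector (e, g).  Passing from the coefficients g to
    the whole remainder is an upper bound only because the diagonal entries of
    [S] are nonnegative. *)
Lemma Omega_cross_bound f M d Q S (Y : 'M[R]_(d + d)) (e : 'cV[R]_(d + d)) :
  (forall a, contI (f a)) -> is_diag S ->
  (forall v, 0 <= qform (Omega M Q S Y) v) ->
  - qform Q e - \intI (fun x => qform (if d == 0%N then 0 else S) (rem_vec f M x))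
  <= 2 * bform e Y (col_mx (next_coefs f M d 0) (next_coefs f M d 1)).
Proof.
move=> cf dS h.
have := h (col_mx e (col_mx (next_coefs f M d 0) (next_coefs f M d 1))).
rewrite Omega_form kron2_form //.
set b := bform e Y _; set b0 := bform _ _ _; set b1 := bform _ _ _ => pos.
suff : S 0 0 * b0 + S 1 1 * b1
    <= \intI (fun x => qform (if d == 0%N then 0 else S) (rem_vec f M x)) by lra.
have [d0|dpos] := posnP d.
  rewrite /b0 /b1 !Delta_form.
  rewrite !big1 ?mulr0 ?addr0 => [|j _|j _]; try by case: j => j; rewrite d0.
  by apply: intI_ge0 => x _; rewrite qform0.
have [S0 S1] := Omega_diag_ge0 dpos dS h.
have cr a : contI (fun x => leg_rem (f a) M.+1 x * leg_rem (f a) M.+1 x).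
  by apply: contIM; exact: contI_rem.
rewrite /=.
have -> : \intI (fun x => qform S (rem_vec f M x))
    = S 0 0 * \intI (fun x => leg_rem (f 0) M.+1 x * leg_rem (f 0) M.+1 x)
    + S 1 1 * \intI (fun x => leg_rem (f 1) M.+1 x * leg_rem (f 1) M.+1 x).
  rewrite -!intIZ // -intID; [|exact: contIM..].
  by apply: eq_intI => x _; rewrite qform_diag2 // !mxE !expr2.
by rewrite lerD // ler_wpM2l // Delta_next_coefs_le.
Qed.

(** The two halves of the cross term carry the same matrix Phi, with the roles
    of [a] and [b] exchanged. *)
Lemma Qcal_leading m k N M d (G : 'M[{poly R}]_(k.+1 + k.+1)) w (a b : 'I_2) :
  (k < m)%N -> Cm m w -> (d <= M)%N -> deg_le d G ->
  let last c := \col_(i < d) whut w c k (M + 1 - d + i) in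
  let next := next_coefs (fun c => pderiv k (w c)) M d in
  Qcal N M G w a b ord_max ord_max
  = bform (last a) (Phi M d G a b) (next b) + bform (last b) (Phi M d G a b) (next a).
Proof.
move=> km Cw dM dG last next.
have dw c : diffI (pderiv k (w c)) by exact: Cm_diffI Cw.
have E c c' : \sum_(i < M.+1) whut w c k i *
    \intI (fun x => (fent G a b ord_max ord_max).[x] * (legendre i).[x] * wtail w c' k M x)
    = bform (last c) (Phi M d G a b) (next c').
  transitivity (\sum_(i < M.+1) whut w c k i *
    \intI (fun x => (fent G a b ord_max ord_max).[x] * (legendre i).[x]
                    * leg_rem (pderiv k (w c')) M.+1 x)).
    apply: eq_bigr => i _; congr (_ * _); apply: intI_mul_tail => //.
    exact: contIM.
  rewrite (@mixed_sum _ _ _ _ _ d) //; [|exact: diffI_contI|exact: dG].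
  rewrite bformE; apply: eq_bigr => i _; apply: eq_bigr => j _.
  rewrite !mxE (_ : (M + 1 - d + i = M - d + i.+1)%N) //; last by lia.
by rewrite /Qcal /Defs.cut /kk eqxx -!E.
Qed.

End LeadingBlock.

(** * The lower bound for the functional *)

Section LowerBound.
Context {R : realType}.

Lemma sum_I2xI2 (F : 'I_2 -> 'I_2 -> R) :
  \sum_(a < 2) \sum_(b < 2) F a b = F 0 0 + F 0 1 + (F 1 0 + F 1 1).
Proof.
have sum2 (g : 'I_2 -> R) : \sum_(a < 2) g a = g 0 + g 1.
  by rewrite !big_ord_recl big_ord0 addr0; congr (g _ + g _); exact/val_inj.
by rewrite sum2 !sum2.
Qed.

Lemma fent_sym k (G : 'M[{poly R}]_(k.+1 + k.+1)) a b al be : G^T = G ->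
  fent G a b al be = fent G b a be al.
Proof. by move=> GT; rewrite /fent -[in LHS]GT mxE. Qed.

Lemma OmegaBar_blocks k M d (G : 'M[{poly R}]_(k.+1 + k.+1)) (Y : auxvars R d) :
  psd (OmegaBar M G Y) ->
  [/\ forall v, 0 <= qform (Omega M (Q11 Y) (S11 Y) (Y11 M d G)) v,
      forall v, 0 <= qform (Omega M (Q12 Y) (S12 Y) (Y12 M d G)) v &
      forall v, 0 <= qform (Omega M (Q22 Y) (S22 Y) (Y22 M d G)) v].
Proof.
move=> [_ h].
have q0 n (A : 'M[R]_n) : bform 0 A 0 = 0 by rewrite /bform mulmx0 mxE.
have blk u v t : 0 <= qform (Omega M (Q11 Y) (S11 Y) (Y11 M d G)) u
    + qform (Omega M (Q12 Y) (S12 Y) (Y12 M d G)) v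
    + qform (Omega M (Q22 Y) (S22 Y) (Y22 M d G)) t.
  have := h (col_mx u (col_mx v t)).
  rewrite -[qform _ _]/(bform _ _ _) /OmegaBar bform_block bform_block !bform0.
  by rewrite !(addr0, add0r) addrA.
split=> v.
- by have := blk v 0 0; rewrite -![qform _ 0]/(bform 0 _ 0) !q0 !addr0.
- by have := blk 0 v 0; rewrite -![qform _ 0]/(bform 0 _ 0) !q0 addr0 add0r.
- by have := blk 0 0 v; rewrite -![qform _ 0]/(bform 0 _ 0) !q0 !add0r.
Qed.

Lemma leading_arith (p00 p01 p11 q1 q2 q3 i1 i2 i3 c00 c01 c11 r00 r01 r10 r11 : R) :
  - q1 - i1 <= c00 -> - q2 - i2 <= c01 -> - q3 - i3 <= c11 ->
  p00 + 2 * p01 + p11 - (q1 + 2 * q2 + q3) - (i1 + 2 * i2 + i3)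
    + (r00 + r01 + (r10 + r11))
  <= p00 + c00 + r00 + (p01 + c01 + r01) + (p01 + c01 + r10 + (p11 + c11 + r11)).
Proof. lra. Qed.

(** By symmetry of [G] the entries (0,1) and (1,0) contribute equally, whence
    the factor 2 in front of the mixed matrices.  The two halves of a cross
    term coincide on the diagonal but not off it, which is why only [Y12] has
    the factor 1/2. *)
Lemma leading_block_lower_bound m k N M d (G : 'M[{poly R}]_(k.+1 + k.+1)) w
    (P : fam R k (dimpsi k M)) (Y : auxvars R d)
    (V := rem_vec (fun a => pderiv k (w a)) M) :
  (k < m)%N -> Cm m w -> (d <= M)%N -> G^T = G -> deg_le d G ->
  (forall a b, Pcal N M G w a b ord_max ord_max
     = qform (P a b ord_max ord_max) (psi k M w)) ->
  aux_wf Y -> psd (OmegaBar M G Y) ->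
  qform (P 0 0 ord_max ord_max + 2 *: P 0 1 ord_max ord_max + P 1 1 ord_max ord_max)
      (psi k M w)
    - qform (Q11 Y + 2 *: Q12 Y + Q22 Y) (last_coefs k M d w)
    - \intI (fun x => qform (if d == 0%N then 0 else S11 Y + 2 *: S12 Y + S22 Y) (V x))
    + \intI (fun x => qform (map_mx (fun q : {poly R} => q.[x]) (Smx G)) (V x))
  <= \sum_(a < 2) \sum_(b < 2) (Pcal N M G w a b ord_max ord_max
       + Qcal N M G w a b ord_max ord_max + Rcal N M G w a b ord_max ord_max).
Proof.
move=> km Cw dM GT dG hP [_ [dS11 dS12 dS22]] /OmegaBar_blocks [psd11 psd12 psd22].
pose f (a : 'I_2) := pderiv k (w a).
have df a : diffI (f a) by exact: Cm_diffI Cw.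
have cf a : contI (f a) by exact: diffI_contI.
have P10 : Pcal N M G w 1 0 ord_max ord_max = Pcal N M G w 0 1 ord_max ord_max.
  rewrite /Pcal /Defs.cut /kk eqxx exchange_big /=; apply: eq_bigr => i _.
  apply: eq_bigr => j _; rewrite (fent_sym 1 0 _ _ GT) (mulrC (whut w 1 _ _)).
  by congr (_ * _); apply: eq_intI => x _; ring.
have Phi10 : Phi M d G 1 0 = Phi M d G 0 1.
  by apply/matrixP => i j; rewrite !mxE (fent_sym 1 0 _ _ GT).
have Q10 : Qcal N M G w 1 0 ord_max ord_max = Qcal N M G w 0 1 ord_max ord_max.
  by rewrite !(Qcal_leading N _ _ km Cw dM dG) Phi10 addrC.
pose e := last_coefs k M d w.
have Qb : Qcal N M G w 0 0 ord_max ord_max = 2 * bform e (Y11 M d G)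
      (col_mx (next_coefs f M d 0) (next_coefs f M d 1))
  /\ Qcal N M G w 0 1 ord_max ord_max = 2 * bform e (Y12 M d G)
      (col_mx (next_coefs f M d 0) (next_coefs f M d 1))
  /\ Qcal N M G w 1 1 ord_max ord_max = 2 * bform e (Y22 M d G)
      (col_mx (next_coefs f M d 0) (next_coefs f M d 1)).
  rewrite !(Qcal_leading N _ _ km Cw dM dG) /e /last_coefs /Y11 /Y12 /Y22 bformZ.
  by rewrite !bform_block !bform0; split; [ring|split; [field|ring]].
have RS : \sum_(a < 2) \sum_(b < 2) Rcal N M G w a b ord_max ord_max
   = \intI (fun x => qform (map_mx (fun q : {poly R} => q.[x]) (Smx G)) (V x)).
  have cr a : contI (leg_rem (f a) M.+1) by exact: contI_rem.
  have cI a b : contI (fun x => (fent G a b ord_max ord_max).[x]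
      * leg_rem (f a) M.+1 x * leg_rem (f b) M.+1 x).
    exact: (@contIM _ _ _ (@contIM _ _ _ (@contI_horner R _) (cr a)) (cr b)).
  transitivity (\intI (fun x => \sum_(a < 2) \sum_(b < 2)
      (fent G a b ord_max ord_max).[x] * leg_rem (f a) M.+1 x * leg_rem (f b) M.+1 x)).
    rewrite intI_sum => [|a _]; last exact: contI_sum.
    apply: eq_bigr => a _; rewrite intI_sum => [|b _]; last exact: cI.
    apply: eq_bigr => b _; rewrite /Rcal /Defs.cut /kk eqxx.
    apply: (eq_intI_interior (cI a b)) => x xI.
    by rewrite /wtail (leg_tailE M (df a) xI) (leg_tailE M (df b) xI).
  apply: eq_intI => x _; rewrite qformE; apply: eq_bigr => a _; apply: eq_bigr => b _.
  by rewrite !mxE; ring.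
case: Qb => Q00 [Q01 Q11'].
have B11 := Omega_cross_bound e cf dS11 psd11; have B12 := Omega_cross_bound e cf dS12 psd12.
have B22 := Omega_cross_bound e cf dS22 psd22.
rewrite -Q00 in B11; rewrite -Q01 in B12; rewrite -Q11' in B22.
have cq (A : 'M[R]_2) : contI (fun x => qform A (V x)).
  by apply: contI_qform_rem_vec.
have SE : \intI (fun x => qform (if d == 0%N then 0 else S11 Y + 2 *: S12 Y + S22 Y) (V x))
  = \intI (fun x => qform (if d == 0%N then 0 else S11 Y) (V x))
  + 2 * \intI (fun x => qform (if d == 0%N then 0 else S12 Y) (V x))
  + \intI (fun x => qform (if d == 0%N then 0 else S22 Y) (V x)).
  have c2 : contI (fun x => 2 * qform (if d == 0%N then 0 else S12 Y) (V x)).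
    by apply: contIM.
  rewrite -(intIZ 2 (cq _)) -(intID (cq _) c2) -(intID (contID (cq _) c2) (cq _)).
  apply: eq_intI => x _; case: ifP => _; first by rewrite !qform0; ring.
  by rewrite !qformD qformZ.
rewrite SE -RS (sum_I2xI2 (fun a b => Rcal N M G w a b ord_max ord_max)).
rewrite (sum_I2xI2 (fun a b => Pcal N M G w a b ord_max ord_max
  + Qcal N M G w a b ord_max ord_max + Rcal N M G w a b ord_max ord_max)).
rewrite P10 Q10 !hP !qformD !qformZ -/e.
exact: leading_arith B11 B12 B22.
Qed.

(** On each remaining block the estimate of the R part is used from below; the
    sums are then regrouped into the quadratic forms of [QM] and [SigmaM]. *)
Lemma Fcal_lower_bound m k N M d (G : 'M[{poly R}]_(k.+1 + k.+1)) w
    (P Q Rm : fam R k (dimpsi k M)) (Sig : fam R k 2)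
    (L : 'M[R]_(d + d, dimpsi k M)) (Y : auxvars R d) :
  (k < m)%N -> Cm m w -> (d <= M)%N -> G^T = G -> deg_le d G ->
  (forall a b al be, Pcal N M G w a b al be = qform (P a b al be) (psi k M w)) ->
  (forall a b al be, (al, be) != kk ->
     Qcal N M G w a b al be = qform (Q a b al be) (psi k M w)) ->
  (forall a b al be, (al, be) != kk ->
     `| Rcal N M G w a b al be | <= leg_norm1 (fent G a b al be) *
        (qform (Rm a b al be) (psi k M w)
         + \intI (fun x => qform (Sig a b al be) (UV k M w x)))) ->
  L *m psi k M w = last_coefs k M d w ->
  aux_wf Y -> psd (OmegaBar M G Y) ->
  qform (QM G L P Q Rm Y) (psi k M w)
  + \intI (fun x => qform (map_mx (fun q : {poly R} => q.[x]) (Smx G) - SigmaM G Sig Y)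
                          (rem_vec (fun a => pderiv k (w a)) M x))
  <= Fcal G w.
Proof.
move=> km Cw dM GT dG hP hQ hR hL wfY psdY.
set V := rem_vec _ M.
have df a : diffI (pderiv k (w a)) by exact: Cm_diffI Cw.
have cf a : contI (pderiv k (w a)) by exact: diffI_contI.
have lead := leading_block_lower_bound km Cw dM GT dG (fun a b => hP a b _ _) wfY psdY.
have cq (A : 'M[R]_2) : contI (fun x => qform A (V x)) by apply: contI_qform_rem_vec.
have cS : contI (fun x => qform (map_mx (fun q : {poly R} => q.[x]) (Smx G)) (V x)).
  apply: contI_qform_rem_vec => // a b.
  rewrite (_ : (fun x => _) = (fun x => (Smx G a b).[x])) //.
  by apply/funext => x; rewrite mxE.
have UVE (A : 'M[R]_2) : \intI (fun x => qform A (UV k M w x)) = \intI (fun x => qform A (V x)).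
  apply: (eq_intI_interior (cq A)) => x xI; congr qform.
  by apply/matrixP => i j; rewrite !mxE /wtail leg_tailE.
have intq_sum (I : Type) (r : seq I) (Pr : pred I) (B : I -> 'M[R]_2) :
    \intI (fun x => qform (\sum_(i <- r | Pr i) B i) (V x))
    = \sum_(i <- r | Pr i) \intI (fun x => qform (B i) (V x)).
  by rewrite -intI_sum //; apply: eq_intI => x _; rewrite qform_sum.
rewrite (Fcal_split N M G km Cw).
have -> : \sum_(a < 2) \sum_(b < 2) \sum_(ab : 'I_k.+1 * 'I_k.+1)
     (Pcal N M G w a b ab.1 ab.2 + Qcal N M G w a b ab.1 ab.2 + Rcal N M G w a b ab.1 ab.2)
  = \sum_(a < 2) \sum_(b < 2) (Pcal N M G w a b ord_max ord_max
       + Qcal N M G w a b ord_max ord_max + Rcal N M G w a b ord_max ord_max)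
  + \sum_(a < 2) \sum_(b < 2) \sum_(ab : 'I_k.+1 * 'I_k.+1 | ab != kk)
     (Pcal N M G w a b ab.1 ab.2 + Qcal N M G w a b ab.1 ab.2 + Rcal N M G w a b ab.1 ab.2).
  rewrite -big_split; apply: eq_bigr => a _; rewrite -big_split; apply: eq_bigr => b _.
  by rewrite (bigD1 kk).
have lower : \sum_(a < 2) \sum_(b < 2) \sum_(ab : 'I_k.+1 * 'I_k.+1 | ab != kk)
      (qform (P a b ab.1 ab.2 + Q a b ab.1 ab.2
              - leg_norm1 (fent G a b ab.1 ab.2) *: Rm a b ab.1 ab.2) (psi k M w)
       - leg_norm1 (fent G a b ab.1 ab.2) *
         \intI (fun x => qform (Sig a b ab.1 ab.2) (V x)))
  <= \sum_(a < 2) \sum_(b < 2) \sum_(ab : 'I_k.+1 * 'I_k.+1 | ab != kk)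
     (Pcal N M G w a b ab.1 ab.2 + Qcal N M G w a b ab.1 ab.2 + Rcal N M G w a b ab.1 ab.2).
  apply: ler_sum => a _; apply: ler_sum => b _; apply: ler_sum => -[al be] /= nkk.
  rewrite hP hQ // qformB qformD qformZ -UVE.
  have := hR a b al be nkk; rewrite ler_norml => /andP[h _].
  by rewrite -!addrA !lerD2l -opprD -mulrDr.
apply: le_trans (lerD lead lower) => {lower lead}.
rewrite /QM qformD qformB qform_congr hL.
have -> : \intI (fun x => qform (map_mx (fun q : {poly R} => q.[x]) (Smx G)
      - SigmaM G Sig Y) (V x))
  = \intI (fun x => qform (map_mx (fun q : {poly R} => q.[x]) (Smx G)) (V x))
    - \intI (fun x => qform (SigmaM G Sig Y) (V x)).
  by rewrite -intIB //; apply: eq_intI => x _; rewrite qformB.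
have -> : \intI (fun x => qform (SigmaM G Sig Y) (V x))
  = \intI (fun x => qform (if d == 0%N then 0 else S11 Y + 2 *: S12 Y + S22 Y) (V x))
    + \sum_(a < 2) \sum_(b < 2) \sum_(ab : 'I_k.+1 * 'I_k.+1 | ab != kk)
       leg_norm1 (fent G a b ab.1 ab.2) * \intI (fun x => qform (Sig a b ab.1 ab.2) (V x)).
  rewrite /SigmaM; set Z := if _ then _ else _; set W := \sum_(a < 2) _.
  transitivity (\intI (fun x => qform Z (V x)) + \intI (fun x => qform W (V x))).
    by rewrite -intID //; apply: eq_intI => x _; rewrite qformD.
  congr (_ + _); rewrite intq_sum; apply: eq_bigr => a _.
  rewrite intq_sum; apply: eq_bigr => b _; rewrite intq_sum; apply: eq_bigr => ab _.
  by rewrite -intIZ //; apply: eq_intI => x _; rewrite qformZ.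
rewrite le_eqVlt; apply/orP; left; apply/eqP.
rewrite qform_sum; under eq_bigr do rewrite qform_sum.
under eq_bigr do under eq_bigr do rewrite qform_sum.
under [in RHS]eq_bigr do under eq_bigr do rewrite sumrB.
under [in RHS]eq_bigr do rewrite sumrB.
by rewrite sumrB; ring.
Qed.

End LowerBound.

(** * Soundness of the semidefinite program *)

Theorem theorem2 (R : realType) (m k l s p dF dT N M q : nat)
  (hk : (1 <= k <= m - 1)%N) (hl : (k <= l <= m)%N)
  (hN : (dF + k - 1 <= N)%N) (hM : M = (N + 2 * k + dF)%N)
  (* problem data *)
  (F0 : 'M[{poly R}]_(k.+1 + k.+1)) (F : 'I_s -> 'M[{poly R}]_(k.+1 + k.+1))
  (hF0sym : F0^T = F0) (hFsym : forall i, (F i)^T = F i)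
  (hF0deg : deg_le dF F0) (hFdeg : forall i, deg_le dF (F i))
  (c : 'cV[R]_s) (A : 'M[R]_(p, dimB l.+1))
  (* the fixed matrices P, Q, R, Sigma indexed by (a, b, al, be) *)
  (P Q : 'cV[R]_s -> fam R k (dimpsi k M)) (Rm : fam R k (dimpsi k M))
  (Sig : fam R k 2)
  (hPaff : forall a b al be, affine_in (fun gamma => P gamma a b al be))
  (hPsym : forall gamma a b al be, (P gamma a b al be)^T = P gamma a b al be)
  (hP : forall gamma a b al be w, Cm m w ->
     Pcal N M (Fmx F0 F gamma) w a b al be
     = qform (P gamma a b al be) (psi k M w))
  (hQaff : forall a b al be, (al, be) != kk ->
     affine_in (fun gamma => Q gamma a b al be))
  (hQsym : forall gamma a b al be, (al, be) != kk ->
     (Q gamma a b al be)^T = Q gamma a b al be)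
  (hQ : forall gamma a b al be w, (al, be) != kk -> Cm m w ->
     Qcal N M (Fmx F0 F gamma) w a b al be
     = qform (Q gamma a b al be) (psi k M w))
  (hRpsd : forall a b al be, (al, be) != kk -> psd (Rm a b al be))
  (hSigpd : forall a b al be, (al, be) != kk -> posdef (Sig a b al be))
  (hR : forall gamma a b al be w, (al, be) != kk -> Cm m w ->
     `| Rcal N M (Fmx F0 F gamma) w a b al be |
     <= leg_norm1 (fent (Fmx F0 F gamma) a b al be) *
        (qform (Rm a b al be) (psi k M w)
         + \intI (fun x => qform (Sig a b al be) (UV k M w x))))
  (* the matrices L, permutation Perm, J, Lambda *)
  (L : 'M[R]_(dF + dF, dimpsi k M))
  (hL : forall w, Cm m w -> L *m psi k M w = last_coefs k M dF w)
  (Perm : 'M[R]_(dimB l.+1, dimB k + dimB (l.+1 - k)))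
  (hPerm : is_permutation Perm)
  (hPermB : forall w, Cm m w ->
     Bvec w 0 l.+1 = Perm *m col_mx (Bvec w 0 k) (Bvec w k (l.+1 - k)))
  (J : 'M[R]_(dimB k, dimpsi k M))
  (hJ : forall w, Cm m w -> Bvec w 0 k = J *m psi k M w)
  (La : 'M[R]_(dimpsi k M + dimB (l.+1 - k), q))
  (hLa : null_basis (Kmx A Perm J) La) :
  let sdp := feasibleSDP dT F0 F P Q Rm Sig L (usubmx La) in
  (optval c [set gamma | feasibleP m F0 F A gamma]
   <= optval c [set gamma | exists Y T, sdp gamma Y T])%E
  /\
  (forall gammaN Y T, sdp gammaN Y T ->
     (forall gamma Y' T', sdp gamma Y' T' ->
        objective c gammaN <= objective c gamma) ->
     feasibleP m F0 F A gammaN).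

Proof.
have key gamma Y T : feasibleSDP dT F0 F P Q Rm Sig L (usubmx La) gamma Y T ->
    feasibleP m F0 F A gamma.
  case=> -[wfY _] psdO psdQ sosA sosT w [Cw BA].
  set G := Fmx F0 F gamma in psdO psdQ sosA *.
  have km : (k < m)%N by lia.
  have dM : (dF <= M)%N by lia.
  have GT : G^T = G.
    rewrite /G /Fmx linearD /= hF0sym; congr (_ + _); rewrite linear_sum /=.
    by apply: eq_bigr => i _; rewrite linearZ /= hFsym.
  have dG : deg_le dF G.
    move=> i j; rewrite /G /Fmx mxE summxE.
    apply: leq_trans (size_polyD _ _) _; rewrite geq_max hF0deg /=.
    apply: leq_trans (size_sum _ _ _) _; apply/bigmax_leqP => u _.
    by rewrite mxE mul_polyC; apply: leq_trans (size_scale_leq _ _) (hFdeg u i j).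
  apply: le_trans (Fcal_lower_bound km Cw dM GT dG
    (fun a b al be => hP gamma a b al be w Cw)
    (fun a b al be n => hQ gamma a b al be w n Cw)
    (fun a b al be n => hR gamma a b al be w n Cw) (hL w Cw) wfY psdO).
  apply: addr_ge0; last first.
    apply: intI_ge0 => x; rewrite inE /= in_itv /= => xI.
    exact: sos_certificate xI sosA sosT.
  (* K maps psi and the outer boundary values to A B^l w, which vanishes. *)
  have [|zeta ->] := @null_basis_state _ _ _ _ _ _ La (psi k M w) (Bvec w k (l.+1 - k)) hLa.
    rewrite /Kmx -mulmxA mul_block_col !mul0mx mul1mx addr0 add0r -hJ //.
    by rewrite -mulmxA -hPermB.
  rewrite -qform_congr; exact: psdQ.2.
split=> [|gammaN Y T sdpN _]; last exact: key sdpN.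
apply: ereal_inf_le_tmp => _ [gamma [Y [T sdpG]] <-].
by exists gamma => //; exact: key sdpG.
Qed.
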